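(* Let $p\in(0,1)$ with $p\neq1/2$, and let $\mu_p$ be the self-similar measure on $[0,1]$ given by the distribution of the random series \[ \sum_{n=1}^\infty X_n(1/2)^n, \] where the $X_n$ are independent random variables with $\mathbb{P}(X_n=0)=p$ and $\mathbb{P}(X_n=1)=1-p$. Then \[ \dim_{\mathrm F}^{\theta}\mu_p\geq\underline{F}_{\mu_p}(\theta)\geq\theta-\theta\log_2\left(1+|2p-1|^{2/\theta}\right) \] for all $\theta\in(0,1)$ and \[ \dim_{\mathrm S}\mu_p=\underline{F}_{\mu_p}(1)=1-\log_2\left(1+|2p-1|^2\right). \] In particular, $\dim_{\mathrm F}^{\theta}\mu_p>\theta\dim_{\mathrm S}\mu_p$ for all $\theta\in(0,1)$, \[ \lim_{\theta\to0}\frac{\dim_{\mathrm F}^{\theta}\mu_p}{\theta}\geq1, \] and \[ \dim_{\mathrm S}\mu_p<\dim_{\mathrm H}\mu_p=\frac{p\log p+(1-p)\log(1-p)}{-\log2}. \]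
   Context: For a finite Borel measure $\mu$ on $\mathbb{R}$ write $\widehat\mu(z)=\int e^{-2\pi i zx}\,d\mu(x)$. For $s\geq 0$ and $\theta\in(0,1]$ let $\mathcal{J}_{s,\theta}(\mu)=\left(\int_{\mathbb{R}}|\widehat\mu(z)|^{2/\theta}|z|^{s/\theta-1}\,dz\right)^{\theta}$. The Fourier spectrum of $\mu$ at $\theta$ is $\dim_{\mathrm F}^{\theta}\mu=\sup\{s\geq 0:\mathcal{J}_{s,\theta}(\mu)<\infty\}\in[0,\infty]$, with $\sup\emptyset=0$, and the Sobolev dimension is $\dim_{\mathrm S}\mu=\dim_{\mathrm F}^{1}\mu$. For $\theta\in(0,1]$, \[ \underline{F}_\mu(\theta)=\liminf_{R\to\infty}\frac{\theta\log\left(R^{-1}\int_{|z|\leq R}|\widehat\mu(z)|^{2/\theta}\,dz\right)}{-\log R}. \] $\dim_{\mathrm H}\mu$ is the Hausdorff dimension of the measure, $\dim_{\mathrm H}\mu=\inf\{\dim_{\mathrm H}E: E \text{ Borel},\ \mu(E)>0\}$. *)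

(* Defs.v *)
From HB Require Import structures.
From mathcomp Require Export all_boot all_order all_algebra.
From mathcomp Require Export all_classical all_reals all_analysis.
From mathcomp Require Export complex.
Set Implicit Arguments.
Unset Strict Implicit.
Unset Printing Implicit Defensive.
Export Order.TTheory GRing.Theory Num.Theory.
Export numFieldNormedType.Exports.

Local Open Scope classical_set_scope.
Local Open Scope ring_scope.

(* The integral of [exp (- 2 pi i z x)], taken on real and imaginary parts:
   the library's integral is real-valued. *)
Definition fourier_transform (R : realType)
    (mu : {finite_measure set R -> \bar R}) (z : R) : R[i] :=
  ((\int[mu]_(x in setT) cos (2 * pi * z * x))
   +i* (- \int[mu]_(x in setT) sin (2 * pi * z * x)))%C.

Definition fourier_modulus (R : realType)
    (mu : {finite_measure set R -> \bar R}) (z : R) : R :=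
  ComplexField.Normc.normc (fourier_transform mu z).

(* The junk value of [`^] at [z = 0] is irrelevant: a point is Lebesgue-null. *)
Definition fourier_energy (R : realType)
    (mu : {finite_measure set R -> \bar R})
    (s theta : R) : \bar R :=
  ((\int[lebesgue_measure]_(z in setT)
     (fourier_modulus mu z `^ (2 / theta) * `|z| `^ (s / theta - 1))%:E)
   `^ theta)%E.

(* [maxe 0] implements the convention that the supremum of the empty set is 0. *)
Definition fourier_spectrum (R : realType)
    (mu : {finite_measure set R -> \bar R})
    (theta : R) : \bar R :=
  maxe 0%E
    (ereal_sup [set s%:E | s in
       [set s : R | 0 <= s /\ (fourier_energy mu s theta < +oo)%E]]).

Definition sobolev_dim (R : realType)
    (mu : {finite_measure set R -> \bar R}) : \bar R :=
  fourier_spectrum mu 1.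

Definition lower_fourier_decay (R : realType)
    (mu : {finite_measure set R -> \bar R})
    (theta : R) : \bar R :=
  limf_einf
    (fun r : R =>
       (theta%:E *
        lne (r^-1%:E *
             \int[lebesgue_measure]_(z in [set z : R | (`|z| <= r)%R])
               (fourier_modulus mu z `^ (2 / theta))%:E) *
        ((- ln r)^-1)%:E)%E)
    (pinfty_nbhs R).

Definition ediam (R : realType) (U : set R) : \bar R :=
  ereal_sup [set `|x.1 - x.2|%:E | x in U `*` U].

(* The empty set contributes 0 even when [s = 0], so that finite covers are
   allowed; a singleton contributes 1 when [s = 0]. *)
Definition hausdorff_gauge (R : realType) (s : R) (U : set R) : \bar R :=
  if U == set0 then 0%E else (ediam U `^ s)%E.

Definition hausdorff_premeasure (R : realType) (s delta : R) (E : set R) :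
    \bar R :=
  ereal_inf [set (\sum_(0 <= i <oo) hausdorff_gauge s (U i))%E | U in
    [set U : (set R)^nat | E `<=` \bigcup_i U i /\
                           forall i, (ediam (U i) <= delta%:E)%E]].

Definition hausdorff_measure (R : realType) (s : R) (E : set R) : \bar R :=
  ereal_sup [set hausdorff_premeasure s delta E | delta in
    [set delta : R | 0 < delta]].

Definition hausdorff_dim (R : realType) (E : set R) : \bar R :=
  ereal_inf [set s%:E | s in
    [set s : R | 0 <= s /\ hausdorff_measure s E = 0%E]].

Definition hausdorff_dim_measure (R : realType)
    (mu : {finite_measure set R -> \bar R}) : \bar R :=
  ereal_inf [set hausdorff_dim E | E in
    [set E : set R | measurable E /\ (0 < mu E)%E]].

Definition mutually_independent d (T : measurableType d) (R : realType)
    (P : probability T R) (I : eqType) (X : I -> {RV P >-> R}) : Prop :=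
  forall (J : seq I) (B : I -> set R),
    uniq J -> (forall j, j \in J -> measurable (B j)) ->
    P (\big[setI/setT]_(j <- J) (X j @^-1` B j)) =
    (\prod_(j <- J) P (X j @^-1` B j))%E.

Definition log2 (R : realType) (x : R) : R := ln x / ln 2.

(* Main.v *)
(** The modulus of the Fourier transform of [mu_p] is a Riesz product: with
    [psi x = |p + (1 - p) e^(-2 pi i x)|^2] one has
    [|mu^ z|^2 = psi (z / 2) psi (z / 4) ...].  Integrating a power [t] of its
    first [n] factors over an interval of length [2 ^ n] and folding the interval
    in two replaces the last factor by [psi x ^ t + psi (x + 1/2) ^ t], which by
    convexity is at most [1 + |2p - 1|^(2t)], with equality for [t = 1].  This
    gives the growth of [|mu^|^(2t)] over balls, hence the bounds on the decay
    exponent; slicing the energy integral into dyadic annuli compares that exponent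
    with the Fourier spectrum.  As [mu^] is not small near the frequencies [2 ^ n],
    the spectrum at [theta] is at most [theta], so its quotient by [theta] tends
    to 1.  The Hausdorff dimension is the entropy: by an exponential Chebyshev
    estimate almost every dyadic interval of length [2 ^- n] has mass
    [2 ^ (- n (h + o(1)))]; counting these intervals bounds the dimension from
    above and the mass distribution principle from below. *)
Require Import Defs.
From mathcomp Require Import ring lra zify measurable_realfun.
Set Implicit Arguments.
Unset Strict Implicit.
Unset Printing Implicit Defensive.
Local Open Scope classical_set_scope.
Local Open Scope ring_scope.

(** Everything is expressed through the real function [fourier_power], the squared modulus: the
    exponent [2 / theta] becomes [t = theta^-1], and [theta <= 1] turns into the condition [1 <= t]
    that convexity asks for. Truncating the product bounds the transform from above only. The
    matching lower bound at [t = 1] rests on [p <> 1/2], which keeps [psi] above [(2p - 1)^2 > 0]: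
    the discarded tail, evaluated at [z / 2 ^ n] in [[0, 1]], stays above a positive constant. On
    the Hausdorff side, neighbouring closed dyadic intervals share end points, so masses are
    computed for events of the probability space, where cylinders are disjoint, and carried to the
    line by the almost sure enclosure of [Y]. The Chebyshev estimate is used in a uniform form:
    outside an event of small probability, all levels beyond some [N] are good. This suffices, since
    the upper bound needs a single set of positive measure, and in the lower bound half of the mass
    of [E] may be thrown away. *)

(** * Binary digits *)

(* For [j < 2 ^ n], the mass of the [j]-th dyadic interval of length [2 ^- n]. *)
Fixpoint digit_weight (R : realType) (p : R) (n j : nat) : R :=
  if n is m.+1 then digit_weight p m j./2 * (if odd j then 1 - p else p) else 1.

(* The first [n] bits, most significant first; anything but 1 counts as the bit
   0, so that the cylinders below are given exactly, without null sets. *)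
Fixpoint dyadic_index (R : realType) (x : nat -> R) (n : nat) : nat :=
  if n is m.+1 then ((dyadic_index x m).*2 + (x m == 1%R))%N else 0%N.

Lemma dyadic_index_lt (R : realType) (x : nat -> R) n :
  (dyadic_index x n < 2 ^ n)%N.
Proof.
elim: n => //= n IH; rewrite expnS.
by case: (_ == _); rewrite /= -mul2n; lia.
Qed.

Lemma dyadic_indexS (R : realType) (x : nat -> R) n j :
  dyadic_index x n.+1 = j <->
  dyadic_index x n = j./2 /\ (x n == 1%R) = odd j.
Proof.
rewrite /=; split=> [<-|[-> ->]].
  by rewrite addnC half_bit_double oddD odd_double; case: (_ == _).
by rewrite addnC odd_double_half.
Qed.

Lemma digit_weight_ge0 (R : realType) (p : R) n j :
  0 <= p <= 1 -> 0 <= digit_weight p n j.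
Proof.
move=> /andP[p0 p1]; elim: n j => //= n IH j; apply: mulr_ge0 => //.
by case: ifP => _; lra.
Qed.

Lemma digit_weight_gt0 (R : realType) (p : R) n j :
  0 < p < 1 -> 0 < digit_weight p n j.
Proof.
move=> /andP[p0 p1]; elim: n j => //= n IH j; apply: mulr_gt0 => //.
by case: ifP => _; lra.
Qed.

Lemma big_pow2S (V : nmodType) (f : nat -> V) n :
  \sum_(j < 2 ^ n.+1) f j = \sum_(i < 2 ^ n) (f i.*2 + f i.*2.+1).
Proof.
rewrite -(big_mkord predT f) -(big_mkord predT (fun i => f i.*2 + f i.*2.+1)).
rewrite expnS mul2n; elim: (2 ^ n)%N => [|m IH].
  by rewrite !big_geq.
by rewrite doubleS 2?big_nat_recr //= big_nat_recr //= IH addrA.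
Qed.

(** Conditioning on the last bit. This recursion is behind every closed form below: total mass,
    exponential moments, Riesz product. *)
Lemma sum_digit_weightS (R : realType) (p : R) (f : nat -> R) n :
  \sum_(j < 2 ^ n.+1) digit_weight p n.+1 j * f j =
  \sum_(i < 2 ^ n) digit_weight p n i * (p * f i.*2 + (1 - p) * f i.*2.+1).
Proof.
rewrite (big_pow2S (fun j => digit_weight p n.+1 j * f j)); apply: eq_bigr => i _ /=.
by rewrite odd_double /= doubleK uphalf_double; ring.
Qed.

Section BernoulliDigits.
Context (R : realType) (p : R) (d : measure_display) (T : measurableType d)
  (P : probability T R) (X : nat -> {RV P >-> R}).
Hypotheses (hX : mutually_independent X)
  (hX0 : forall n, P (X n @^-1` [set 0]) = p%:E)
  (hX1 : forall n, P (X n @^-1` [set 1]) = (1 - p)%:E).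

Definition digit_set (b : bool) : set R := if b then [set 1] else ~` [set 1].

Lemma measurable_digit_set b : measurable (digit_set b).
Proof. by case: b; [|apply: measurableC]; exact: measurable_set1. Qed.

Lemma prob_digit_set n b :
  P (X n @^-1` digit_set b) = (if b then 1 - p else p)%:E.
Proof.
case: b; first exact: hX1.
rewrite /digit_set -preimage_setC probability_setC ?hX1; last first.
  by rewrite -[_ @^-1` _]setTI; apply: measurable_funP => //; exact: measurable_set1.
by rewrite -EFinB; congr (_%:E); ring.
Qed.

Definition index_event n j : set T :=
  [set w | dyadic_index (fun k => X k w) n = j].

Lemma index_eventS n j :
  index_event n.+1 j = index_event n j./2 `&` X n @^-1` digit_set (odd j).
Proof.
apply/seteqP; split=> w; rewrite /index_event.
  move=> /dyadic_indexS[? /= Hb]; split=> //=.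
  by move: Hb; case: (odd j) => /eqP.
move=> [Hj Hb]; apply/dyadic_indexS; split=> //.
move: Hb; rewrite /digit_set /=; case: (odd j) => /= [->|H]; first exact: eqxx.
exact/eqP.
Qed.

Lemma measurable_index_event n j : measurable (index_event n j).
Proof.
elim: n j => [j|n IH j].
  by rewrite /index_event /=; case: j => [|j];
    [rewrite [X in measurable X](_ : _ = setT) ?predeqE|
     rewrite [X in measurable X](_ : _ = set0) ?predeqE].
rewrite index_eventS; apply: measurableI => //.
by rewrite -[_ @^-1` _]setTI; apply: measurable_funP => //;
  exact: measurable_digit_set.
Qed.

Lemma prob_index_event n j : (j < 2 ^ n)%N ->
  P (index_event n j) = (digit_weight p n j)%:E.
Proof.
(* Independence speaks of a whole finite family at once, so the induction only collects the digit
   sets [B]; [hX] is applied once, at the end. *)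
suff H : (j < 2 ^ n)%N -> exists B : nat -> set R,
    [/\ forall k, measurable (B k),
       index_event n j = \big[setI/setT]_(k <- iota 0 n) (X k @^-1` B k) &
       (\prod_(k <- iota 0 n) P (X k @^-1` B k))%E = (digit_weight p n j)%:E].
  by move=> /H[B [mB -> <-]]; apply: hX; [exact: iota_uniq|].
elim: n j => [|n IH] j jn.
  exists (fun=> setT); split=> //; rewrite !big_nil //.
  by apply/seteqP; split=> // w _; rewrite /index_event /=; move: jn; case: j.
have /IH[B [mB Bj Bp]] : (j./2 < 2 ^ n)%N.
  by move: jn; rewrite expnS; lia.
exists (fun k => if k == n then digit_set (odd j) else B k).
have Bk k : k \in iota 0 n -> (k == n) = false.
  by rewrite mem_iota add0n => /andP[_ kn]; apply/eqP; lia.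
split=> [k||].
- by case: ifP => // _; exact: measurable_digit_set.
- rewrite index_eventS -addn1 iotaD add0n big_cat big_seq1 eqxx Bj /=.
  by congr (_ `&` _); apply: eq_big_seq => k /Bk ->.
- rewrite -addn1 iotaD add0n big_cat big_seq1 eqxx addn1 /= EFinM -Bp.
  rewrite prob_digit_set; congr (_ * _)%E.
  by apply: eq_big_seq => k /Bk ->.
Qed.

(** A function of the index is a simple function; its measurability and its integral then come from
    finitely many cylinders. *)
Lemma dyadic_index_indic n (g : nat -> R) w :
  g (dyadic_index (fun k => X k w) n) =
  \sum_(j < 2 ^ n) g j * \1_(index_event n j) w.
Proof.
have Hn := @dyadic_index_lt R (fun k => X k w) n.
rewrite (bigD1 (Ordinal Hn)) //= indicE mem_set // mulr1.
rewrite big1 ?addr0 // => i /eqP iH.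
rewrite indicE memNset ?mulr0 // => /= E.
by apply: iH; apply: val_inj => /=; rewrite E.
Qed.

Lemma measurable_dyadic_index n (g : nat -> R) :
  measurable_fun setT (fun w => g (dyadic_index (fun k => X k w) n)).
Proof.
under eq_fun do rewrite dyadic_index_indic.
apply: measurable_sum => j; apply: measurable_funM => //.
by apply: measurable_indic; exact: measurable_index_event.
Qed.

Lemma integral_dyadic_index n (g : nat -> R) :
  (\int[P]_w (g (dyadic_index (fun k => X k w) n))%:E =
   (\sum_(j < 2 ^ n) digit_weight p n j * g j)%:E)%E.
Proof.
under eq_integral do rewrite dyadic_index_indic -sumEFin.
have ii (A : set T) : measurable A -> P.-integrable setT (fun w => (\1_A w)%:E).
  by move=> mA; exact: integrable_indic.
rewrite integral_sum //=; last first.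
  move=> j; under eq_fun do rewrite EFinM.
  by apply: integrableZl => //; apply: ii; exact: measurable_index_event.
rewrite -sumEFin; apply: eq_bigr => j _.
under eq_integral do rewrite EFinM.
rewrite integralZl //; last by apply: ii; exact: measurable_index_event.
rewrite integral_indic ?setIT //; last exact: measurable_index_event.
transitivity ((g j)%:E * (digit_weight p n j)%:E)%E; last by rewrite -EFinM mulrC.
by congr (_ * _)%E; exact: prob_index_event.
Qed.

End BernoulliDigits.

(** * Dyadic expansions and large deviations *)

Lemma nneseries_geometric_le (R : realType) (u : nat -> \bar R) (K q : R) :
  (forall n, 0 <= u n)%E -> (forall n, u n <= (K * q ^+ n)%:E)%E ->
  0 <= K -> 0 < q -> q < 1 ->
  (\sum_(0 <= n <oo) u n <= (K / (1 - q))%:E)%E.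
Proof.
move=> u0 uK K0 q0 q1.
have nq : `|q| < 1 by rewrite gtr0_norm.
apply: lime_le; first exact: is_cvg_nneseries.
apply: nearW => n.
apply: (@le_trans _ _ (\sum_(0 <= k < n) (K * q ^+ k)%:E)%E); first exact: lee_sum.
by rewrite sumEFin lee_fin; have := @geometric_le_lim R n K q K0 q0 nq.
Qed.

Section DyadicExpansion.
Context (R : realType) (x : nat -> R).
Hypothesis bits : forall k, x k = 0 \/ x k = 1.

Lemma dyadic_seriesE n :
  series (fun k => x k * (1 / 2) ^+ k.+1) n = (dyadic_index x n)%:R / 2 ^+ n.
Proof.
elim: n => [|n IH]; first by rewrite /series /= big_geq // mul0r.
rewrite /series /= big_nat_recr //= -[X in X + _]/(series (fun k => x k * (1 / 2) ^+ k.+1) n) IH natrD -mul2n natrM.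
have -> : ((x n == 1)%:R : R) = x n by case: (bits n) => ->; rewrite ?eqxx // eq_sym oner_eq0.
by rewrite expr_div_n expr1n !exprS; field.
Qed.

Lemma dyadic_index_ratio_nd n m : (n <= m)%N ->
  (dyadic_index x n)%:R / 2 ^+ n <= (dyadic_index x m)%:R / 2 ^+ m :> R.
Proof.
elim: m => [|m IH]; first by rewrite leqn0 => /eqP ->.
rewrite leq_eqVlt => /orP[/eqP -> //|]; rewrite ltnS => /IH/le_trans; apply.
have h2 : (0 : R) < 2 ^+ m by rewrite exprn_gt0.
rewrite /= exprS invfM mulrA ler_wpM2r ?invr_ge0 ?(ltW h2) // natrD -mul2n natrM.
have : 0 <= ((x m == 1)%:R : R) by [].
move: ((x m == 1)%:R : R) => b; lra.
Qed.

Lemma dyadic_index_succ_ratio_ni n m : (n <= m)%N ->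
  (dyadic_index x m).+1%:R / 2 ^+ m <= (dyadic_index x n).+1%:R / 2 ^+ n :> R.
Proof.
elim: m => [|m IH]; first by rewrite leqn0 => /eqP ->.
rewrite leq_eqVlt => /orP[/eqP -> //|]; rewrite ltnS => /IH; apply: le_trans.
have h2 : (0 : R) < 2 ^+ m by rewrite exprn_gt0.
rewrite /= exprS invfM mulrA ler_wpM2r ?invr_ge0 ?(ltW h2) //.
rewrite -[in leLHS]natr1 -[in leRHS]natr1 natrD -mul2n natrM.
have : ((x m == 1)%:R : R) <= 1 by case: (_ == _).
move: ((x m == 1)%:R : R) => b; lra.
Qed.

(** The dyadic intervals given by the indices are nested, hence all contain the limit. They are
    closed on the right because a tail of ones reaches the right end point. *)
Lemma dyadic_index_bounds (y : R) n :
  series (fun k => x k * (1 / 2) ^+ k.+1) @ \oo --> y ->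
  (dyadic_index x n)%:R / 2 ^+ n <= y <= (dyadic_index x n).+1%:R / 2 ^+ n.
Proof.
have -> : series (fun k => x k * (1 / 2) ^+ k.+1) =
  (fun m => (dyadic_index x m)%:R / 2 ^+ m) by apply/funext => m; exact: dyadic_seriesE.
move=> H; have cv := cvgP _ H; rewrite -(cvg_lim _ H) //; apply/andP; split.
  apply: limr_ge => //; near=> m; apply: dyadic_index_ratio_nd.
  by near: m; exact: nbhs_infty_ge.
apply: limr_le => //; near=> m.
apply: le_trans (dyadic_index_succ_ratio_ni (_ : (n <= m)%N)).
  by rewrite ler_wpM2r ?invr_ge0 ?exprn_ge0 // ler_nat.
by near: m; exact: nbhs_infty_ge.
Unshelve. all: by end_near. Qed.

End DyadicExpansion.

(** From [1 - x <= expR (- x)] one gets [(1 - x) * expR x <= 1], while [(1 + x + 2 x^2) (1 - x) = 1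
    + x^2 (1 - 2 x)] is at least 1. *)
Lemma expR_le_quadratic (R : realType) (x : R) :
  `|x| <= 1 / 2 -> expR x <= 1 + x + 2 * x ^+ 2.
Proof.
rewrite ler_norml => /andP[x1 x2].
have := expR_ge1Dx (- x); rewrite expRN => H.
have e0 := expR_gt0 x.
have H1 : (1 - x) * expR x <= 1.
  by have := ler_wpM2r (ltW e0) H; rewrite mulVf ?gt_eqF.
have : 0 <= (1 + x + 2 * x ^+ 2 - expR x) * (1 - x) by nra.
by rewrite pmulr_lge0 ?subr_ge0 //; lra.
Qed.

(* Expanding at [t = 0]: the derivative there is the negative mean. *)
Lemma exists_exponential_moment_lt1 (R : realType) (p a b : R) :
  0 < p < 1 -> p * a + (1 - p) * b < 0 ->
  exists2 t, 0 < t & p * expR (t * a) + (1 - p) * expR (t * b) < 1.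
Proof.
move=> /andP[p0 p1] m0.
pose M := `|a| + `|b| + 1.
have M1 : 1 <= M by rewrite /M; have := normr_ge0 a; have := normr_ge0 b; lra.
have aM : `|a| <= M by rewrite /M; have := normr_ge0 b; lra.
have bM : `|b| <= M by rewrite /M; have := normr_ge0 a; lra.
pose c := - (p * a + (1 - p) * b).
have cM : c <= M.
  rewrite /c; move: aM bM; rewrite !ler_norml => /andP[a1 a2] /andP[b1 b2]; nra.
(* The minimiser of [1 - t c + 2 t^2 M^2], the bound that the quadratic estimate gives for the
   moment; the minimum is [1 - t c / 2]. *)
pose t := c / (4 * M ^+ 2).
have c0 : 0 < c by rewrite /c oppr_gt0.
have MM : 0 < 4 * M ^+ 2 by nra.
have t0 : 0 < t by rewrite /t divr_gt0.
have tM : t * M <= 1 / 2.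
  rewrite /t mulrAC ler_pdivrMr //; nra.
have tE : t * (4 * M ^+ 2) = c by rewrite /t mulfVK // gt_eqF.
have ta : `|t * a| <= 1 / 2.
  by rewrite normrM gtr0_norm //; apply: le_trans tM; rewrite ler_pM2l.
have tb : `|t * b| <= 1 / 2.
  by rewrite normrM gtr0_norm //; apply: le_trans tM; rewrite ler_pM2l.
exists t => //.
have Ha := expR_le_quadratic ta; have Hb := expR_le_quadratic tb.
have a2 : a ^+ 2 <= M ^+ 2 by rewrite -(real_normK (num_real a)) lerXn2r // nnegrE; lra.
have b2 : b ^+ 2 <= M ^+ 2 by rewrite -(real_normK (num_real b)) lerXn2r // nnegrE; lra.
have t2 : 0 < t ^+ 2 by rewrite exprn_gt0.
have Ha2 : (t * a) ^+ 2 <= t ^+ 2 * M ^+ 2 by rewrite exprMn ler_pM2l.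
have Hb2 : (t * b) ^+ 2 <= t ^+ 2 * M ^+ 2 by rewrite exprMn ler_pM2l.
have tc : t * c = 4 * (t ^+ 2 * M ^+ 2) by rewrite -tE; ring.
have tcp : 0 < t * c by rewrite mulr_gt0.
have tcE : t * c = - (p * (t * a) + (1 - p) * (t * b)) by rewrite /c; ring.
have pa : p * expR (t * a) <= p * (1 + t * a + 2 * (t ^+ 2 * M ^+ 2)).
  by rewrite ler_pM2l //; apply: le_trans Ha _; lra.
have pb : (1 - p) * expR (t * b) <= (1 - p) * (1 + t * b + 2 * (t ^+ 2 * M ^+ 2)).
  by rewrite ler_pM2l ?subr_gt0 //; apply: le_trans Hb _; lra.
set u := t ^+ 2 * M ^+ 2 in tc pa pb.
lra.
Qed.

(** With the steps [c + ln p] and [c + ln (1 - p)] this walk is [n c] plus the logarithm of the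
    cylinder mass, so its sign compares that mass with [expR (- n c)]. *)
Fixpoint digit_sum (R : realType) (a b : R) (n j : nat) : R :=
  if n is m.+1 then digit_sum a b m j./2 + (if odd j then b else a) else 0.

Lemma sum_digit_weight_expR (R : realType) (p a b t : R) n :
  \sum_(j < 2 ^ n) digit_weight p n j * expR (t * digit_sum a b n j) =
  (p * expR (t * a) + (1 - p) * expR (t * b)) ^+ n.
Proof.
elim: n => [|n IH]; first by rewrite big_ord1 /= mulr0 expR0 mul1r.
rewrite (sum_digit_weightS p (fun j => expR (t * digit_sum a b n.+1 j))).
rewrite exprSr -IH mulr_suml; apply: eq_bigr => i _ /=.
by rewrite odd_double /= doubleK uphalf_double !mulrDr !expRD; ring.
Qed.

(** * Exponential Chebyshev estimates for sums over the digits *)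

Section LargeDeviations.
Context (R : realType) (p : R) (d : measure_display) (T : measurableType d)
  (P : probability T R) (X : nat -> {RV P >-> R}).
Hypotheses (hp0 : 0 < p) (hp1 : p < 1) (hX : mutually_independent X)
  (hX0 : forall n, P (X n @^-1` [set 0]) = p%:E)
  (hX1 : forall n, P (X n @^-1` [set 1]) = (1 - p)%:E).

Local Notation J n w := (dyadic_index (fun k => X k w) n).

Lemma ae_bits : {ae P, forall w n, X n w = 0 \/ X n w = 1}.
Proof.
apply: ae_foralln => n.
exists (~` (X n @^-1` [set 0] `|` X n @^-1` [set 1])).
have m (c : R) : measurable (X n @^-1` [set c]).
  by rewrite -[_ @^-1` _]setTI; apply: measurable_funP => //; exact: measurable_set1.
have m01 := measurableU _ _ (m 0) (m 1).
split; first exact: measurableC.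
- transitivity (1 - P (X n @^-1` [set 0%R] `|` X n @^-1` [set 1%R]))%E.
    exact: probability_setC.
  rewrite measureU //; last first.
    by apply/seteqP; split=> // w [/= -> /eqP]; rewrite eq_sym oner_eq0.
  transitivity (1 - (p%:E + (1 - p)%:E))%E.
    by congr (1 - (_ + _))%E; [exact: hX0|exact: hX1].
  have -> : (p%:E + (1 - p)%:E = 1)%E by rewrite -EFinD; congr (_%:E); ring.
  exact: subee.
- by move=> w /= H H'; apply: H.
Qed.

Definition tail_event (a b : R) n : set T :=
  [set w | 0 <= digit_sum a b n (J n w)].

Lemma measurable_tail_event a b n : measurable (tail_event a b n).
Proof.
rewrite -[tail_event _ _ _]setTI.
have -> : tail_event a b n = (fun w => digit_sum a b n (J n w)) @^-1` `[0, +oo[.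
  by apply/seteqP; split=> w; rewrite /tail_event /= in_itv /= andbT.
exact: measurable_dyadic_index.
Qed.

(** The indicator of the event is at most [expR (t * digit_sum a b n j)], whose expectation is a
    product over the digits. *)
Lemma prob_tail_event a b t n : 0 < t ->
  (P (tail_event a b n) <=
   ((p * expR (t * a) + (1 - p) * expR (t * b)) ^+ n)%:E)%E.
Proof.
move=> t0; rewrite -sum_digit_weight_expR.
rewrite -(integral_dyadic_index hX hX1 n (fun j => expR (t * digit_sum a b n j))).
have mA := measurable_tail_event a b n.
have -> : P (tail_event a b n) = (\int[P]_w (\1_(tail_event a b n) w)%:E)%E.
  by rewrite integral_indic // setIT.
apply: ge0_le_integral => //.
- apply/measurable_EFinP; exact: measurable_indic.
- apply/measurable_EFinP.
  exact: (measurable_dyadic_index X n (fun j => expR (t * digit_sum a b n j))).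
- move=> w _; rewrite lee_fin indicE.
  case: (boolP (w \in _)) => [|_]; last exact: expR_ge0.
  rewrite inE /tail_event /= => H.
  by rewrite -expR0 ler_expR mulr_ge0 // ltW.
Qed.

(** With negative drift the probabilities of the tail events decay geometrically, so a union bound
    controls all levels from [N] on at once. *)
Lemma prob_tail_events_small a b (eps : R) :
  p * a + (1 - p) * b < 0 -> 0 < eps ->
  exists N, (P (\bigcup_n tail_event a b (N + n)%N) <= eps%:E)%E.
Proof.
move=> /(exists_exponential_moment_lt1 (introT andP (conj hp0 hp1)))[t t0].
set r := (X in X < 1) => r1 e0.
have r0 : 0 < r.
  by rewrite /r addr_gt0 // mulr_gt0 ?expR_gt0 // subr_gt0.
have nr : `|r| < 1 by rewrite gtr0_norm.
have [N HN] : exists N, r ^+ N <= eps * (1 - r).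
  have := cvg_geometric 1 nr => /cvgrPdist_le /(_ (eps * (1 - r))).
  rewrite mulr_gt0 ?subr_gt0 // => /(_ isT)[N _ /(_ N (leqnn N))].
  rewrite /= sub0r normrN mul1r ger0_norm; last exact: exprn_ge0 (ltW r0).
  by move=> H; exists N.
exists N.
apply: (@le_trans _ _ (\sum_(0 <= n <oo) P (tail_event a b (N + n)%N))%E).
  apply: measure_sigma_subadditive => //.
  - by move=> n; exact: measurable_tail_event.
  - by apply: bigcup_measurable => n _; exact: measurable_tail_event.
apply: (@le_trans _ _ (r ^+ N / (1 - r))%:E).
  apply: nneseries_geometric_le => //; last by apply: exprn_ge0; exact: ltW.
  by move=> n; rewrite -exprD; exact: prob_tail_event.
by rewrite lee_fin ler_pdivrMr // subr_gt0.
Qed.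

End LargeDeviations.

(** * The Riesz product *)

Definition bernoulli_symbol (R : realType) (p x : R) : R :=
  p ^+ 2 + (1 - p) ^+ 2 + 2 * p * (1 - p) * cos (2 * pi * x).

Definition riesz_product (R : realType) (p : R) (n : nat) (z : R) : R :=
  \prod_(k < n) bernoulli_symbol p (z / 2 ^+ k.+1).

(** The squared modulus of the transform, kept real; the sign of the imaginary part disappears in
    the square. *)
Definition fourier_power (R : realType)
    (mu : {finite_measure set R -> \bar R}) (z : R) : R :=
  (\int[mu]_(x in setT) cos (2 * pi * z * x)) ^+ 2 +
  (\int[mu]_(x in setT) sin (2 * pi * z * x)) ^+ 2.

Section BernoulliSymbol.
Context (R : realType) (p : R).
Hypotheses (hp0 : 0 < p) (hp1 : p < 1).
Implicit Types (x z : R) (n k : nat).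

Lemma bernoulli_symbol_ge x : (2 * p - 1) ^+ 2 <= bernoulli_symbol p x.
Proof.
rewrite /bernoulli_symbol; have := cos_geN1 (2 * pi * x).
move: (cos _) => c c1; have : 0 <= p * (1 - p) * (1 + c).
  by move: hp0 hp1 => p0 p1; apply: mulr_ge0; [apply: mulr_ge0|]; lra.
nra.
Qed.

Lemma bernoulli_symbol_ge0 x : 0 <= bernoulli_symbol p x.
Proof. exact: le_trans (sqr_ge0 _) (bernoulli_symbol_ge x). Qed.

Lemma bernoulli_symbol_le1 x : bernoulli_symbol p x <= 1.
Proof.
rewrite /bernoulli_symbol; have := cos_le1 (2 * pi * x).
move: (cos _) => c c1; have : 0 <= p * (1 - p) * (1 - c).
  by move: hp0 hp1 => p0 p1; apply: mulr_ge0; [apply: mulr_ge0|]; lra.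
nra.
Qed.

Lemma bernoulli_symbolDn x n : bernoulli_symbol p (x + n%:R) = bernoulli_symbol p x.
Proof.
rewrite /bernoulli_symbol; congr (_ + _ * _).
rewrite -(periodicn (@cosD2pi R) n (2 * pi * x)); congr cos.
by rewrite mulrDr -mulrnA -[pi *+ (2 * n)]mulr_natr natrM; ring.
Qed.

(** The cosine changes sign under the half shift. That the sum is constant makes the integral at
    [t = 1] exact. *)
Lemma bernoulli_symbol_half x :
  bernoulli_symbol p x + bernoulli_symbol p (x + 1 / 2) = 1 + (2 * p - 1) ^+ 2.
Proof.
rewrite /bernoulli_symbol.
have -> : 2 * pi * (x + 1 / 2) = 2 * pi * x + pi by field.
by rewrite cosDpi; ring.
Qed.

Lemma continuous_bernoulli_symbol : continuous (bernoulli_symbol p).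
Proof.
move=> x; apply: cvgD; first exact: cvg_cst.
apply: cvgM; first exact: cvg_cst.
apply: continuous_comp; last exact: continuous_cos.
by apply: cvgM; [exact: cvg_cst|exact: cvg_id].
Qed.

Lemma riesz_productS n z :
  riesz_product p n.+1 z = bernoulli_symbol p (z / 2) * riesz_product p n (z / 2).
Proof.
rewrite /riesz_product big_ord_recl /= expr1; congr (_ * _).
by apply: eq_bigr => i _; rewrite /bump /= add1n exprS invfM mulrA.
Qed.

Lemma riesz_productSr n z :
  riesz_product p n.+1 z = riesz_product p n z * bernoulli_symbol p (z / 2 ^+ n.+1).
Proof. by rewrite /riesz_product big_ord_recr. Qed.

Lemma riesz_productD n m z :
  riesz_product p (n + m) z = riesz_product p n z * riesz_product p m (z / 2 ^+ n).
Proof.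
rewrite /riesz_product big_split_ord /=; congr (_ * _).
by apply: eq_bigr => i _; rewrite -addnS exprD invfM mulrA.
Qed.

Lemma riesz_product_ge0 n z : 0 <= riesz_product p n z.
Proof. by apply: prodr_ge0 => k _; exact: bernoulli_symbol_ge0. Qed.

Lemma riesz_product_le1 n z : riesz_product p n z <= 1.
Proof.
by apply: prodr_ile1 => k _; rewrite bernoulli_symbol_ge0 bernoulli_symbol_le1.
Qed.

Lemma riesz_product_ge n z : ((2 * p - 1) ^+ 2) ^+ n <= riesz_product p n z.
Proof.
elim: n z => [|n IH] z; first by rewrite /riesz_product big_ord0 expr0.
rewrite riesz_productS exprS; apply: ler_pM => //.
- exact: sqr_ge0.
- by apply: exprn_ge0; exact: sqr_ge0.
- exact: bernoulli_symbol_ge.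
Qed.

(** The factor of index [k < n] has period [2 ^ k.+1], which divides [2 ^ n]. *)
Lemma riesz_productDpow2 n z m :
  riesz_product p n (z + (m * 2 ^ n)%:R) = riesz_product p n z.
Proof.
apply: eq_bigr => k _.
rewrite -[RHS](bernoulli_symbolDn _ (m * 2 ^ (n - k.+1))); congr bernoulli_symbol.
rewrite -{1}(subnK (ltn_ord k)) expnD mulrDl mulnA natrM natrX mulfK //.
Qed.

Lemma continuous_riesz_product n : continuous (riesz_product p n).
Proof.
elim: n => [|n IH] x.
  rewrite (_ : riesz_product p 0 = cst 1); last first.
    by apply/funext => z; rewrite /riesz_product big_ord0.
  exact: cvg_cst.
rewrite (_ : riesz_product p n.+1 = (fun z => riesz_product p n z *
  bernoulli_symbol p (z / 2 ^+ n.+1))); last by apply/funext => z; exact: riesz_productSr.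
apply: cvgM; first exact: IH.
apply: continuous_cvg; first exact: continuous_bernoulli_symbol.
by apply: cvgM; [exact: cvg_id|exact: cvg_cst].
Qed.

Let wcos n z := \sum_(j < 2 ^ n) digit_weight p n j * cos (2 * pi * z * (j%:R / 2 ^+ n)).
Let wsin n z := \sum_(j < 2 ^ n) digit_weight p n j * sin (2 * pi * z * (j%:R / 2 ^+ n)).

(** [wcos - i wsin] is the transform of the measure with mass [digit_weight p n j] at [j / 2 ^ n]. A
    further bit multiplies it by [p + (1 - p) e^(- i a)], written out below in real and imaginary
    parts. *)
Lemma riesz_productE n z : wcos n z ^+ 2 + wsin n z ^+ 2 = riesz_product p n z.
Proof.
elim: n => [|n IH].
  rewrite /wcos /wsin /riesz_product big_ord0 !big_ord1 /= !mul1r mul0r mulr0.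
  by rewrite cos0 sin0; ring.
pose a := 2 * pi * (z / 2 ^+ n.+1).
have e0 i : 2 * pi * z * ((i.*2)%:R / 2 ^+ n.+1) = 2 * pi * z * (i%:R / 2 ^+ n) :> R.
  by rewrite -mul2n natrM exprS; field; rewrite expf_neq0.
have e1 i : 2 * pi * z * ((i.*2.+1)%:R / 2 ^+ n.+1) = 2 * pi * z * (i%:R / 2 ^+ n) + a :> R.
  by rewrite -(e0 i) /a -[in LHS]natr1; ring.
have wc : wcos n.+1 z = (p + (1 - p) * cos a) * wcos n z - (1 - p) * sin a * wsin n z.
  rewrite /wcos /wsin (sum_digit_weightS p (fun j => cos (2 * pi * z * (j%:R / 2 ^+ n.+1)))).
  rewrite !mulr_sumr -sumrB; apply: eq_bigr => i _.
  by rewrite e0 e1 cosD; ring.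
have ws : wsin n.+1 z = (p + (1 - p) * cos a) * wsin n z + (1 - p) * sin a * wcos n z.
  rewrite /wcos /wsin (sum_digit_weightS p (fun j => sin (2 * pi * z * (j%:R / 2 ^+ n.+1)))).
  rewrite !mulr_sumr -big_split; apply: eq_bigr => i _ /=.
  by rewrite e0 e1 sinD; ring.
rewrite riesz_productSr -IH wc ws /bernoulli_symbol -/a.
have := cos2Dsin2 a; move: (cos a) (sin a) (wcos n z) (wsin n z) => c s A B E.
transitivity ((A ^+ 2 + B ^+ 2) * (p ^+ 2 + (1 - p) ^+ 2 * (c ^+ 2 + s ^+ 2) + 2 * p * (1 - p) * c)).
  by ring.
by rewrite E mulr1; ring.
Qed.

End BernoulliSymbol.

Lemma sum_digit_weight (R : realType) (p : R) n :
  \sum_(j < 2 ^ n) digit_weight p n j = 1.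
Proof.
elim: n => [|n IH]; first by rewrite big_ord1.
under eq_bigr do rewrite -[digit_weight _ _ _]mulr1.
rewrite (sum_digit_weightS p (fun=> 1) n) -[RHS]IH; apply: eq_bigr => i _; ring.
Qed.

(** * The Fourier transform of the distribution of [Y] as an infinite Riesz product *)

Section FourierTransform.
Context (R : realType) (p : R) (d : measure_display) (T : measurableType d)
  (P : probability T R) (X : nat -> {RV P >-> R}) (Y : {RV P >-> R}).
Hypotheses (hp0 : 0 < p) (hp1 : p < 1) (hX : mutually_independent X)
  (hX0 : forall n, P (X n @^-1` [set 0]) = p%:E)
  (hX1 : forall n, P (X n @^-1` [set 1]) = (1 - p)%:E)
  (hS : {ae P, forall w,
       series (fun n => X n w * (1 / 2) ^+ n.+1) @ \oo --> Y w}).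

Local Notation J n w := (dyadic_index (fun k => X k w) n).
Local Notation mu := (distribution P Y).

Lemma ae_dyadic_bounds : {ae P, forall w, (forall n, X n w = 0 \/ X n w = 1) /\
  forall n, (J n w)%:R / 2 ^+ n <= Y w <= (J n w).+1%:R / 2 ^+ n}.
Proof.
apply: filterS2 (ae_bits hX0 hX1) hS => w Hb Hs; split=> // n.
exact: dyadic_index_bounds.
Qed.

(** Weak convergence of the discretised measures: the left end points converge to [Y] almost surely,
    and dominated convergence applies with the constant 1. *)
Lemma cvg_digit_weight_sum (g : R -> R) : continuous g -> (forall x, `|g x| <= 1) ->
  (\sum_(j < 2 ^ n) digit_weight p n j * g (j%:R / 2 ^+ n)) @[n --> \oo]
  --> \int[mu]_(x in setT) g x.
Proof.
move=> cg g1.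
have mg : measurable_fun setT g by exact: continuous_measurable_fun.
have mgY : measurable_fun setT (g \o Y) by exact: measurableT_comp.
have i1 : P.-integrable setT (EFin \o cst 1) by exact: finite_measure_integrable_cst.
have igY : P.-integrable setT (EFin \o (g \o Y)).
  apply: le_integrable i1 => //; first exact/measurable_EFinP.
  by move=> w _ /=; rewrite lee_fin normr1; exact: g1.
have -> : \int[mu]_(x in setT) g x = fine (\int[P]_w (g (Y w))%:E)%E.
  rewrite /Rintegral; congr fine.
  by rewrite (integral_distribution (X := Y) (f := EFin \o g)) //; exact/measurable_EFinP.
rewrite (_ : (fun n => _) = fun n => fine (\int[P]_w (g ((J n w)%:R / 2 ^+ n))%:E)%E); last first.
  apply/funext => n.
  by rewrite (integral_dyadic_index hX hX1 n (fun j => g (j%:R / 2 ^+ n))).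
apply: fine_cvg; rewrite fineK; last first.
  exact: integrable_fin_num.
have mJ n : measurable_fun setT (fun w => (g ((J n w)%:R / 2 ^+ n))%:E).
  apply/measurable_EFinP.
  exact: (measurable_dyadic_index X n (fun j => g (j%:R / 2 ^+ n))).
have cJ : {ae P, forall w, setT w ->
    (fun n => (g ((J n w)%:R / 2 ^+ n))%:E) @ \oo --> (g (Y w))%:E}.
  apply: filterS ae_dyadic_bounds => w [_ Hw] _.
  apply: cvg_EFin; first by near=> n.
  apply: continuous_cvg; first exact: cg.
  apply: (@squeeze_cvgr _ _ _ _ (fun n => Y w - (1 / 2) ^+ n) (cst (Y w))).
  - near=> n; have /andP[H1 H2] := Hw n; rewrite H1 andbT.
    move: H2; rewrite -natr1 mulrDl expr_div_n expr1n; lra.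
  - rewrite -[X in _ --> X]subr0; apply: cvgB; first exact: cvg_cst.
    apply: (@cvg_expr R (1 / 2)); rewrite gtr0_norm; lra.
  - exact: cvg_cst.
have dJ : {ae P, forall w n, setT w ->
    (`|(g ((J n w)%:R / 2 ^+ n))%:E| <= (EFin \o cst 1%R) w)%E}.
  by apply: nearW => w n _ /=; rewrite lee_fin; exact: g1.
have mY : measurable_fun setT (fun w => (g (Y w))%:E) by exact/measurable_EFinP.
by have [] := dominated_convergence measurableT mJ mY cJ i1 dJ.
Unshelve. all: by end_near. Qed.

Lemma cvg_riesz_product z : riesz_product p n z @[n --> \oo] --> fourier_power mu z.
Proof.
rewrite (_ : (fun n => _) = fun n =>
    (\sum_(j < 2 ^ n) digit_weight p n j * cos (2 * pi * z * (j%:R / 2 ^+ n))) ^+ 2 +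
    (\sum_(j < 2 ^ n) digit_weight p n j * sin (2 * pi * z * (j%:R / 2 ^+ n))) ^+ 2); last first.
  by apply/funext => n; rewrite -riesz_productE.
have cm : continuous (fun x : R => 2 * pi * z * x).
  by move=> x; apply: cvgM; [exact: cvg_cst|exact: cvg_id].
apply: cvgD; apply: cvgM.
all: [> apply: (cvg_digit_weight_sum (g := fun x => cos (2 * pi * z * x)))
      | apply: (cvg_digit_weight_sum (g := fun x => cos (2 * pi * z * x)))
      | apply: (cvg_digit_weight_sum (g := fun x => sin (2 * pi * z * x)))
      | apply: (cvg_digit_weight_sum (g := fun x => sin (2 * pi * z * x)))].
all: try (by move=> x; first [exact: cos_max|exact: sin_max]).
all: move=> x; apply: continuous_comp; first exact: cm.
all: first [exact: continuous_cos|exact: continuous_sin].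
Qed.

(** Self-similarity at scale [2 ^ n]: the limit of [riesz_productD] in the number of remaining
    factors. *)
Lemma fourier_power_riesz n z :
  fourier_power mu z = riesz_product p n z * fourier_power mu (z / 2 ^+ n).
Proof.
apply: (@cvg_unique _ _ (riesz_product p (k + n)%N z @[k --> \oo])) => //.
  by have /= := @cvg_riesz_product z; rewrite -(cvg_shiftn n).
rewrite /= (_ : (fun k => _) = fun k => riesz_product p n z *
    riesz_product p k (z / 2 ^+ n)); last first.
  by apply/funext => k; rewrite addnC riesz_productD.
by apply: cvgM; [exact: cvg_cst|exact: cvg_riesz_product].
Qed.

Lemma fourier_power_ge0 z : 0 <= fourier_power mu z.
Proof. by rewrite addr_ge0 // sqr_ge0. Qed.

Lemma fourier_power_le1 z : fourier_power mu z <= 1.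
Proof.
have cv := @cvg_riesz_product z; rewrite -(cvg_lim _ cv) //.
apply: limr_le; first exact: cvgP cv.
by apply: nearW => n; exact: riesz_product_le1.
Qed.

Lemma fourier_power_le_riesz n z : fourier_power mu z <= riesz_product p n z.
Proof.
rewrite (fourier_power_riesz n) ler_piMr ?riesz_product_ge0 //.
exact: fourier_power_le1.
Qed.

Lemma measurable_fourier_power : measurable_fun setT (fourier_power mu).
Proof.
apply: (@measurable_fun_cvg _ _ _ _ (fun n => riesz_product p n)) => // [n|z _].
  by apply: continuous_measurable_fun; exact: continuous_riesz_product.
exact: cvg_riesz_product.
Qed.

(** For [x] in [[0, 1]] the phase [2 pi z x] stays within [pi / 4] of 0, so the cosine integral
    alone is large enough. The bound is read off the discretisations, whose atoms lie in
    [[0, 1]]. *)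
Lemma fourier_power_near0 z : `|z| <= 1 / 8 ->
  cos (pi / 4) ^+ 2 <= fourier_power mu z.
Proof.
move=> z8.
have c0 : 0 <= cos (pi / 4 : R).
  by apply: cos_ge0_pihalf; have := pi_gt0 R; lra.
have cx (x : R) : 0 <= x <= 1 -> cos (pi / 4) <= cos (2 * pi * z * x).
  move=> /andP[x0 x1]; have pi0 := pi_gt0 R.
  have E : `|2 * pi * z * x| <= pi / 4.
    have pi2 : 0 < 2 * pi :> R by rewrite mulr_gt0.
    rewrite !normrM -normrM (gtr0_norm pi2) (ger0_norm x0) -mulrA.
    rewrite (_ : pi / 4 = 2 * pi * (1 / 8 * 1)); last by field.
    by rewrite ler_pM2l //; apply: ler_pM.
  rewrite -(cos_norm (2 * pi * z * x)) leNgt ltr_cos ?in_itv /= -?leNgt //.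
    by apply/andP; split; lra.
  by rewrite normr_ge0 /=; apply: le_trans E _; lra.
have cI : cos (pi / 4) <= \int[mu]_(x in setT) cos (2 * pi * z * x).
  have cv := cvg_digit_weight_sum (g := fun x => cos (2 * pi * z * x)).
  rewrite -(cvg_lim _ (cv _ _)) //; last 2 first.
  - move=> x; apply: continuous_comp; last exact: continuous_cos.
    by apply: cvgM; [exact: cvg_cst|exact: cvg_id].
  - by move=> x; exact: cos_max.
  apply: limr_ge.
    apply: cvgP (cv _ _); last by move=> x; exact: cos_max.
    move=> x; apply: continuous_comp; last exact: continuous_cos.
    by apply: cvgM; [exact: cvg_cst|exact: cvg_id].
  apply: nearW => n.
  rewrite -[leLHS]mul1r -[X in X * _](sum_digit_weight p n) mulr_suml; apply: ler_sum => j _.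
  rewrite ler_wpM2l ?digit_weight_ge0 ?(ltW hp0) ?(ltW hp1) //.
  apply: cx; rewrite divr_ge0 ?exprn_ge0 //= ler_pdivrMr ?exprn_gt0 // mul1r.
  by rewrite -natrX ler_nat ltnW.
rewrite /fourier_power -[leLHS]addr0 lerD ?sqr_ge0 // lerXn2r ?nnegrE //; last first.
  by apply: le_trans cI.
Qed.

(* Four halvings bring [z] within reach of [fourier_power_near0]. *)
Lemma fourier_power_near_le2 z : `|z| <= 2 ->
  ((2 * p - 1) ^+ 2) ^+ 4 * cos (pi / 4) ^+ 2 <= fourier_power mu z.
Proof.
move=> z2; rewrite (fourier_power_riesz 4).
apply: ler_pM; [by apply: exprn_ge0; exact: sqr_ge0|exact: sqr_ge0| |].
  exact: riesz_product_ge.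
apply: fourier_power_near0; rewrite normrM (ger0_norm (_ : 0 <= (2 ^+ 4)^-1)) //.
by move: z2; move: `|z| => y; rewrite !exprS expr0; lra.
Qed.

(* The integer frequencies [2 ^ n] are invisible to the first [n] factors. *)
Lemma fourier_power_shift n z :
  fourier_power mu z * fourier_power mu (1 + z / 2 ^+ n) <=
  fourier_power mu (2 ^+ n + z).
Proof.
rewrite (fourier_power_riesz n (2 ^+ n + z)).
have -> : (2 ^+ n + z) / 2 ^+ n = 1 + z / 2 ^+ n by field; rewrite expf_neq0.
rewrite ler_wpM2r ?fourier_power_ge0 // addrC -natrX -[(2 ^ n)%N]mul1n.
by rewrite riesz_productDpow2; exact: fourier_power_le_riesz.
Qed.

End FourierTransform.

(** * Integrals of the Riesz product *)

Lemma integral_translation (R : realType) (f : R -> R) (a b c : R) :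
  a <= b -> continuous f ->
  (\int[lebesgue_measure]_(x in `[(a + c)%R, (b + c)%R]) (f x)%:E =
   \int[lebesgue_measure]_(x in `[a, b]) (f (x + c))%:E)%E.
Proof.
move=> ab cf.
have D1 : (fun x : R => x + c)^`()%classic = cst 1.
  by apply/funext => x; rewrite derive1E deriveD // derive_id derive_cst addr0.
rewrite (@integration_by_substitution_increasing _ (fun x => x + c) f a b) //.
- by apply: eq_integral => x _; rewrite D1 /= mulr1.
- by move=> x y _ _ xy; rewrite ltrD2r.
- by rewrite D1 => x _; exact: cvg_cst.
- by rewrite D1; exact: is_cvg_cst.
- by rewrite D1; exact: is_cvg_cst.
- split.
  + by move=> x _; exact: derivableD.
  + by apply: cvg_at_right_filter; apply: cvgD; [exact: cvg_id|exact: cvg_cst].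
  + by apply: cvg_at_left_filter; apply: cvgD; [exact: cvg_id|exact: cvg_cst].
- by apply: continuous_subspaceT => x; exact: cf.
Qed.

Lemma integral_fold (R : realType) (f : R -> R) (a l : R) : 0 <= l ->
  continuous f -> (forall x, 0 <= f x) ->
  (\int[lebesgue_measure]_(x in `[a, (a + l + l)%R]) (f x)%:E =
   \int[lebesgue_measure]_(x in `[a, (a + l)%R]) (f x + f (x + l))%:E)%E.
Proof.
move=> l0 cf f0.
have mf D : measurable D -> measurable_fun D (EFin \o f).
  move=> mD; apply/measurable_EFinP; apply: measurable_funTS.
  exact: continuous_measurable_fun.
have -> : `[a, a + l + l]%classic = `[a, a + l[ `|` `[a + l, a + l + l] :> set R.
  apply/seteqP; split=> x /=; rewrite !in_itv /=.
    by move=> /andP[ax xl]; case: (ltP x (a + l)) => H; [left|right]; rewrite ?ax ?xl.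
  by move=> [/andP[ax xl]|/andP[ax xl]]; apply/andP; split; lra.
rewrite ge0_integral_setU //=; last 3 first.
- by apply: mf; apply: measurableU; exact: measurable_itv.
- by move=> x _; rewrite lee_fin.
- rewrite disj_set2E; apply/eqP/seteqP; split=> x //=; rewrite !in_itv /=.
  by move=> [/andP[_ H] /andP[H' _]]; lra.
rewrite integral_itv_bndo_bndc; last exact: mf.
rewrite integral_translation ?lerDl //.
under [in RHS]eq_integral do rewrite EFinD.
rewrite ge0_integralD //.
- by move=> x _; rewrite lee_fin.
- exact: mf.
- by move=> x _; rewrite lee_fin.
- apply/measurable_EFinP; apply: measurable_funTS; apply: continuous_measurable_fun.
  move=> x; apply: continuous_comp; last exact: cf.
  by apply: cvgD; [exact: cvg_id|exact: cvg_cst].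
Qed.

(** Both [a] and [b] lie between [m] and 1. Writing each as a convex combination of 1 and [m], the
    two weights of 1 add up to 1 because [a + b = 1 + m]. *)
Lemma powR_add_le (R : realType) (m a b t : R) : 0 <= m -> m < 1 ->
  m <= a -> m <= b -> a + b = 1 + m -> 1 <= t ->
  a `^ t + b `^ t <= 1 + m `^ t.
Proof.
move=> m0 m1 ma mb ab t1.
have H (c : R) : m <= c -> c <= 1 ->
    c `^ t <= (c - m) / (1 - m) + (1 - (c - m) / (1 - m)) * m `^ t.
  move=> mc c1.
  have l0 : 0 <= (c - m) / (1 - m) by apply: divr_ge0; lra.
  have l1 : (c - m) / (1 - m) <= 1 by rewrite ler_pdivrMr; lra.
  have := @convex_powR R t t1 (Itv01 l0 l1) 1 m.
  rewrite !inE /= !in_itv /= !andbT ler01 => /(_ isT m0).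
  set l := (c - m) / (1 - m) in l0 l1 *.
  move=> H; have {H} : (l * 1 + (1 - l) * m) `^ t <= l * 1 `^ t + (1 - l) * m `^ t := H.
  rewrite powR1 !mulr1.
  have lE : l * (1 - m) = c - m by rewrite /l divfK //; lra.
  by rewrite (_ : l + (1 - l) * m = c) //; rewrite mulrBl mul1r; lra.
have Ha := H a ma; have Hb := H b mb.
have -> : 1 + m `^ t = ((a - m) / (1 - m) + (1 - (a - m) / (1 - m)) * m `^ t) +
    ((b - m) / (1 - m) + (1 - (b - m) / (1 - m)) * m `^ t).
  have -> : b = 1 + m - a by lra.
  by field; lra.
by apply: lerD; [apply: Ha|apply: Hb]; lra.
Qed.

Section RieszProductIntegral.
Context (R : realType) (p t : R).
Hypotheses (hp0 : 0 < p) (hp1 : p < 1) (hp : p != 1 / 2) (t1 : 1 <= t).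

Local Notation B := (1 + ((2 * p - 1) ^+ 2) `^ t).

Lemma bernoulli_bias : 0 < (2 * p - 1) ^+ 2 < 1.
Proof.
move: hp0 hp1 hp => p0 p1 /eqP p2; apply/andP; split; last by nra.
rewrite lt_neqAle sqr_ge0 andbT eq_sym sqrf_eq0; apply/eqP => H.
by apply: p2; lra.
Qed.

Lemma riesz_product_gt0 n z : 0 < riesz_product p n z.
Proof.
apply: lt_le_trans (riesz_product_ge hp0 hp1 n z).
by apply: exprn_gt0; have /andP[] := bernoulli_bias.
Qed.

Lemma continuous_riesz_product_powR n :
  continuous (fun z => riesz_product p n z `^ t).
Proof.
move=> z.
rewrite (_ : (fun z => _) = fun z => expR (t * ln (riesz_product p n z))); last first.
  by apply/funext => x; rewrite /powR gt_eqF // riesz_product_gt0.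
apply: continuous_comp; last exact: continuous_expR.
apply: cvgM; first exact: cvg_cst.
apply: continuous_comp; first exact: continuous_riesz_product.
by apply: continuous_ln; exact: riesz_product_gt0.
Qed.

Lemma riesz_product_powR_fold n z :
  riesz_product p n.+1 z `^ t + riesz_product p n.+1 (z + 2 ^+ n) `^ t =
  riesz_product p n z `^ t * (bernoulli_symbol p (z / 2 ^+ n.+1) `^ t +
    bernoulli_symbol p (z / 2 ^+ n.+1 + 1 / 2) `^ t).
Proof.
have -> : z + 2 ^+ n = z + (1 * 2 ^ n)%:R by rewrite mul1n natrX.
rewrite !riesz_productSr riesz_productDpow2 !powRM ?riesz_product_ge0 ?bernoulli_symbol_ge0 //.
rewrite mulrDr; congr (_ + _ * bernoulli_symbol _ _ `^ _).
by rewrite mul1n natrX exprS; field; rewrite expf_neq0.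
Qed.

Lemma bernoulli_symbol_powR_half x :
  bernoulli_symbol p x `^ t + bernoulli_symbol p (x + 1 / 2) `^ t <= B.
Proof.
have /andP[b0 b1] := bernoulli_bias.
apply: powR_add_le => //; first exact: ltW.
- exact: bernoulli_symbol_ge.
- exact: bernoulli_symbol_ge.
- exact: bernoulli_symbol_half.
Qed.

Lemma measurable_riesz_powR D n : measurable D ->
  measurable_fun D (fun z => (riesz_product p n z `^ t)%:E).
Proof.
move=> mD; apply/measurable_EFinP; apply: measurable_funTS.
apply: continuous_measurable_fun; exact: continuous_riesz_product_powR.
Qed.

(* Translation by [2 ^ n] only changes the last factor. *)
Lemma integral_riesz_foldE (a : R) n :
  (\int[lebesgue_measure]_(z in `[a, (a + 2 ^+ n.+1)%R]) (riesz_product p n.+1 z `^ t)%:E =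
   \int[lebesgue_measure]_(z in `[a, (a + 2 ^+ n)%R]) (riesz_product p n z `^ t *
     (bernoulli_symbol p (z / 2 ^+ n.+1) `^ t +
      bernoulli_symbol p (z / 2 ^+ n.+1 + 1 / 2) `^ t))%:E)%E.
Proof.
rewrite (_ : a + 2 ^+ n.+1 = a + 2 ^+ n + 2 ^+ n); last by rewrite exprS; ring.
rewrite integral_fold //; first last.
- by move=> z; exact: powR_ge0.
- exact: continuous_riesz_product_powR.
by apply: eq_integral => z _; rewrite riesz_product_powR_fold.
Qed.

Lemma measurable_riesz_fold D n : measurable D ->
  measurable_fun D (fun z => (riesz_product p n z `^ t *
     (bernoulli_symbol p (z / 2 ^+ n.+1) `^ t +
      bernoulli_symbol p (z / 2 ^+ n.+1 + 1 / 2) `^ t))%:E).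
Proof.
move=> mD.
rewrite (_ : (fun z => _) = (fun z => (riesz_product p n.+1 z `^ t +
    riesz_product p n.+1 (z + 2 ^+ n) `^ t)%:E)); last first.
  by apply/funext => z; rewrite riesz_product_powR_fold.
apply/measurable_EFinP; apply: measurable_funTS; apply: continuous_measurable_fun.
move=> x; apply: cvgD; first exact: continuous_riesz_product_powR.
suff : {for x, continuous ((fun z => riesz_product p n.+1 z `^ t) \o
    (fun z => z + 2 ^+ n))} by [].
apply: continuous_comp; first by apply: cvgD; [exact: cvg_id|exact: cvg_cst].
exact: continuous_riesz_product_powR.
Qed.

Lemma integral_riesz_product_le (a : R) n :
  (\int[lebesgue_measure]_(z in `[a, (a + 2 ^+ n)%R]) (riesz_product p n z `^ t)%:E
   <= (B ^+ n)%:E)%E.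
Proof.
elim: n => [|n IH].
  under eq_integral do rewrite /riesz_product big_ord0 powR1.
  by rewrite integral_cst //= mul1e lebesgue_measure_itv /= lte_fin ltrDl ltr01 -EFinB lee_fin; lra.
rewrite integral_riesz_foldE.
have B0 : 0 <= B by rewrite addr_ge0 // powR_ge0.
apply: (@le_trans _ _ (\int[lebesgue_measure]_(z in `[a, (a + 2 ^+ n)%R])
    (B%:E * (riesz_product p n z `^ t)%:E))%E).
  apply: ge0_le_integral => //.
  - by move=> z _; rewrite lee_fin mulr_ge0 ?powR_ge0 // addr_ge0 // powR_ge0.
  - exact: measurable_riesz_fold.
  - by apply: emeasurable_funM => //; exact: measurable_riesz_powR.
  - move=> z _; rewrite -EFinM lee_fin mulrC ler_wpM2r ?powR_ge0 //.
    exact: bernoulli_symbol_powR_half.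
rewrite ge0_integralZl_EFin //; last exact: measurable_riesz_powR.
  by rewrite [_ ^+ n.+1]exprS EFinM; apply: lee_wpmul2l.
by move=> z _; rewrite lee_fin powR_ge0.
Qed.

End RieszProductIntegral.

Lemma integral_riesz_product (R : realType) (p a : R) n :
  0 < p -> p < 1 -> p != 1 / 2 ->
  (\int[lebesgue_measure]_(z in `[a, (a + 2 ^+ n)%R]) (riesz_product p n z)%:E
   = ((1 + (2 * p - 1) ^+ 2) ^+ n)%:E)%E.
Proof.
move=> hp0 hp1 hp; elim: n => [|n IH].
  under eq_integral do rewrite /riesz_product big_ord0.
  by rewrite integral_cst //= mul1e lebesgue_measure_itv /= lte_fin ltrDl ltr01 -EFinB; congr (_%:E); lra.
have r1 k z : riesz_product p k z = riesz_product p k z `^ 1.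
  by rewrite powRr1 // riesz_product_ge0.
under eq_integral do rewrite r1.
rewrite integral_riesz_foldE //.
transitivity (\int[lebesgue_measure]_(z in `[a, (a + 2 ^+ n)%R])
    ((1 + (2 * p - 1) ^+ 2)%:E * (riesz_product p n z)%:E))%E.
  apply: eq_integral => z _; rewrite !powRr1 ?bernoulli_symbol_ge0 ?riesz_product_ge0 //.
  by rewrite bernoulli_symbol_half -EFinM mulrC.
rewrite ge0_integralZl_EFin //.
- by rewrite IH [_ ^+ n.+1]exprS EFinM.
- by move=> z _; rewrite lee_fin riesz_product_ge0.
- apply/measurable_EFinP; apply: measurable_funTS.
  by apply: continuous_measurable_fun; exact: continuous_riesz_product.
- by rewrite addr_ge0 // sqr_ge0.
Qed.

(** * Energy integrals and growth over balls *)

Definition ball_energy (R : realType)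
    (mu : {finite_measure set R -> \bar R}) (t r : R) : \bar R :=
  (\int[lebesgue_measure]_(z in [set z : R | (`|z| <= r)%R])
     (fourier_power mu z `^ t)%:E)%E.

Lemma fourier_modulus_powR (R : realType)
    (mu : {finite_measure set R -> \bar R}) (z theta : R) :
  fourier_modulus mu z `^ (2 / theta) = fourier_power mu z `^ theta^-1.
Proof.
rewrite /fourier_modulus /fourier_transform /= sqrrN -/(fourier_power mu z).
have D0 : 0 <= fourier_power mu z by rewrite addr_ge0 // sqr_ge0.
by rewrite powRrM powR_mulrn ?sqrtr_ge0 // sqr_sqrtr.
Qed.

Lemma sym_itvE (R : realType) (r : R) : [set z : R | `|z| <= r] = `[- r, r]%classic.
Proof. by apply/seteqP; split=> z /=; rewrite in_itv /= ler_norml. Qed.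

(* [E = 0], where [lne] is [-oo], and [E = +oo] are included. *)
Lemma growth_ratio_ge (R : realType) (theta x r : R) (E : \bar R) :
  0 < theta -> 1 < r -> (0 <= E)%E ->
  (x%:E <= theta%:E * lne (r^-1%:E * E) * ((- ln r)^-1)%:E)%E =
  (E <= (r `^ (1 - x / theta))%:E)%E.
Proof.
move=> t0 r1; have r0 : 0 < r by lra.
have ri0 : 0 < r^-1 by rewrite invr_gt0.
have l0 : 0 < ln r by rewrite ln_gt0.
have nl0 : (- ln r)^-1 < 0 by rewrite invr_lt0 oppr_lt0.
case: E => [e| |] //=; last first.
  move=> _; rewrite gt0_muley ?lte_fin //= gt0_muley ?lte_fin // lt0_mulye ?lte_fin //.
rewrite lee_fin le_eqVlt => /orP[/eqP <-|e0].
  rewrite mulr0 lexx gt0_muleNy ?lte_fin // lt0_mulNye ?lte_fin // leey.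
  by rewrite lee_fin powR_ge0.
rewrite (leNgt (r^-1 * e)) mulr_gt0 //= lee_fin.
rewrite -[e in RHS]lnK ?posrE // /powR gt_eqF // lee_fin ler_expR.
rewrite lnM ?posrE // lnV ?posrE // invrN mulrN -mulNr ler_pdivlMr //.
rewrite -[in RHS](ler_pM2l t0).
have -> : theta * ((1 - x / theta) * ln r) = theta * ln r - x * ln r.
  by field; rewrite gt_eqF.
by apply/idP/idP => H; nra.
Qed.

Lemma growth_ratio_le (R : realType) (theta x r : R) (E : \bar R) :
  0 < theta -> 1 < r -> (0 <= E)%E ->
  (theta%:E * lne (r^-1%:E * E) * ((- ln r)^-1)%:E <= x%:E)%E =
  ((r `^ (1 - x / theta))%:E <= E)%E.
Proof.
move=> t0 r1; have r0 : 0 < r by lra.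
have ri0 : 0 < r^-1 by rewrite invr_gt0.
have l0 : 0 < ln r by rewrite ln_gt0.
have nl0 : (- ln r)^-1 < 0 by rewrite invr_lt0 oppr_lt0.
case: E => [e| |] //=; last first.
  move=> _; rewrite gt0_muley ?lte_fin //= gt0_muley ?lte_fin // lt0_mulye ?lte_fin //.
  by rewrite leNye leey.
rewrite lee_fin le_eqVlt => /orP[/eqP <-|e0].
  rewrite mulr0 lexx gt0_muleNy ?lte_fin // lt0_mulNye ?lte_fin // leye_eq.
  by rewrite lee_fin /= leNgt powR_gt0.
rewrite (leNgt (r^-1 * e)) mulr_gt0 //= lee_fin.
rewrite -[e in RHS]lnK ?posrE // /powR gt_eqF // lee_fin ler_expR.
rewrite lnM ?posrE // lnV ?posrE // invrN mulrN -mulNr ler_pdivrMr //.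
rewrite -[in RHS](ler_pM2l t0).
have -> : theta * ((1 - x / theta) * ln r) = theta * ln r - x * ln r.
  by field; rewrite gt_eqF.
by apply/idP/idP => H; nra.
Qed.

Lemma powRD_pos (R : realType) (x r s : R) : 0 < x ->
  x `^ (r + s) = x `^ r * x `^ s.
Proof. by move=> x0; rewrite powRD // (gt_eqF x0) implybT. Qed.

(** Absorbs a constant into an arbitrarily small loss of exponent; the threshold solves
    [K r^b = r^c]. *)
Lemma powR_dominates (R : realType) (K b c : R) : 0 < K -> b < c ->
  exists M, forall r, M < r -> 1 < r -> K * r `^ b <= r `^ c.
Proof.
move=> K0 bc; exists (expR (ln K / (c - b))) => r Mr r1.
have r0 : 0 < r by lra.
have cb : 0 < c - b by rewrite subr_gt0.
rewrite (_ : c = b + (c - b)); last by ring.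
rewrite powRD_pos // mulrC ler_wpM2l ?powR_ge0 //.
rewrite /powR gt_eqF // -[leLHS]lnK ?posrE // ler_expR mulrC -ler_pdivrMr //.
by rewrite -ler_expR lnK ?posrE // ltW.
Qed.

(** The absolute value in the constant covers both signs of [e], as the weight exponent
    [s / theta - 1] may have either. *)
Lemma powR_dyadic_comparable (R : realType) (e x y : R) :
  0 < y -> y / 2 <= x -> x <= y -> x `^ e <= 2 `^ `|e| * y `^ e.
Proof.
move=> y0 yx xy; have x0 : 0 < x by lra.
rewrite /powR !gt_eqF // -expRD ler_expR.
have l1 : ln x <= ln y by rewrite ler_ln.
have l2 : ln y <= ln 2 + ln x.
  by rewrite -lnM ?posrE // ler_ln ?posrE ?mulr_gt0 //; lra.
have l3 : `|e * (ln x - ln y)| <= `|e| * ln 2.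
  by rewrite normrM ler_wpM2l // ler_norml; apply/andP; split; lra.
by have := ler_norm (e * (ln x - ln y)); lra.
Qed.

Lemma powR_pow2 (R : realType) (n : nat) (s : R) :
  ((2 ^+ n)^-1 : R) `^ s = expR (- (n%:R * s * ln 2)).
Proof.
have p2 : 0 < 2 ^+ n :> R by rewrite exprn_gt0.
rewrite /powR gt_eqF ?invr_gt0 // lnV ?posrE // lnXn //.
by congr expR; rewrite -mulr_natl; ring.
Qed.

Lemma powR_exprn (R : realType) (a x : R) (k : nat) : 0 <= a ->
  (a ^+ k) `^ x = (a `^ x) ^+ k.
Proof.
move=> a0; elim: k => [|k IH]; first by rewrite !expr0 powR1.
by rewrite !exprS powRM ?exprn_ge0 // IH.
Qed.

Lemma dyadic_scale (R : realType) (x : R) : 1 <= x ->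
  exists k, 2 ^+ k <= x < 2 ^+ k.+1.
Proof.
move=> x1.
have [n xn] : exists n, x < 2 ^+ n.
  exists (Num.bound x); apply: lt_le_trans (archi_boundP _) _; first lra.
  by rewrite -natrX ler_nat ltnW // ltn_expl.
elim: n xn => [|n IH] xn; first by exists 0%N; rewrite expr0 in xn *; lra.
by case: (ltP x (2 ^+ n)) => [/IH //|H]; exists n; rewrite H.
Qed.

(** * Decay exponent, ball growth and Fourier spectrum for a general measure *)

Section Generic.
Context (R : realType) (mu : {finite_measure set R -> \bar R}) (theta : R).
Hypotheses (theta0 : 0 < theta)
  (mmu : measurable_fun setT (fourier_power mu))
  (mu1 : forall z, fourier_power mu z <= 1).

Local Notation leb := (@lebesgue_measure R).

Lemma measurable_sym (r : R) : measurable [set z : R | `|z| <= r].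
Proof. by rewrite sym_itvE; exact: measurable_itv. Qed.

Lemma lebesgue_sym (r : R) : 0 <= r -> leb [set z : R | `|z| <= r] = (2 * r)%:E.
Proof.
move=> r0; rewrite sym_itvE lebesgue_measure_itv /= lte_fin.
case: ltP => H; first by rewrite -EFinB; congr (_%:E); ring.
by congr (_%:E); lra.
Qed.

Lemma integral_indic_sym (r : R) : 0 <= r ->
  (\int[leb]_z (\1_[set z : R | (`|z| <= r)%R] z)%:E = (2 * r)%:E)%E.
Proof.
move=> r0; rewrite integral_indic //; last exact: measurable_sym.
by rewrite setIT; exact: lebesgue_sym.
Qed.

Lemma measurable_fourier_powR t D : measurable D ->
  measurable_fun D (fun z => (fourier_power mu z `^ t)%:E).
Proof.
move=> mD; apply/measurable_EFinP; apply: measurable_funTS.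
exact: measurableT_comp (measurable_powR t) mmu.
Qed.

Lemma fourier_powR_le1 (t z : R) : 0 <= t -> fourier_power mu z `^ t <= 1.
Proof.
move=> t0; have <- : 1 `^ t = 1 :> R by rewrite powR1.
apply: ge0_ler_powR => //.
  by rewrite nnegrE addr_ge0 // sqr_ge0.
by rewrite nnegrE.
Qed.

Lemma ball_energy_ge0 t r : (0 <= ball_energy mu t r)%E.
Proof. by apply: integral_ge0 => z _; rewrite lee_fin powR_ge0. Qed.

Lemma ball_energy_mono t r r' : r <= r' ->
  (ball_energy mu t r <= ball_energy mu t r')%E.
Proof.
move=> rr; apply: ge0_subset_integral.
- exact: measurable_sym.
- exact: measurable_sym.
- by apply: measurable_fourier_powR; exact: measurable_sym.
- by move=> z _; rewrite lee_fin powR_ge0.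
- by move=> z /= /le_trans; apply.
Qed.

Lemma fourier_modulus_powR_fun :
  (fun z => (fourier_modulus mu z `^ (2 / theta))%:E) =
  (fun z => (fourier_power mu z `^ theta^-1)%:E).
Proof. by apply/funext => z; rewrite fourier_modulus_powR. Qed.

Lemma lower_fourier_decayE : lower_fourier_decay mu theta =
  ereal_sup [set ereal_inf ((fun r : R =>
    (theta%:E * lne (r^-1%:E * ball_energy mu theta^-1 r) * ((- ln r)^-1)%:E)%E) @` V)
  | V in pinfty_nbhs R].
Proof.
by rewrite /lower_fourier_decay fourier_modulus_powR_fun limf_einfE.
Qed.

(** A decay exponent [x] corresponds to ball growth of exponent [1 - x / theta]. Lowering [x] by [e]
    makes this exceed [b], which swallows [K] for large radii. *)
Lemma lower_fourier_decay_ge (K b : R) : 0 < K ->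
  (forall r, 1 < r -> (ball_energy mu theta^-1 r <= (K * r `^ b)%:E)%E) ->
  ((theta * (1 - b))%:E <= lower_fourier_decay mu theta)%E.
Proof.
move=> K0 H; apply/lee_subgt0Pr => e e0; rewrite -EFinB.
set x := _ - e.
have bx : b < 1 - x / theta.
  by rewrite ltrBrDl -ltrBrDr ltr_pdivrMr // /x mulrC; lra.
have [M HM] := powR_dominates K0 bx.
rewrite lower_fourier_decayE; apply: ereal_sup_ge.
exists (ereal_inf ((fun r : R => (theta%:E * lne (r^-1%:E * ball_energy mu theta^-1 r) *
   ((- ln r)^-1)%:E)%E) @` [set r | Num.max M 1 < r])).
  exists [set r | Num.max M 1 < r] => //.
  by exists (Num.max M 1); split=> //; exact: num_real.
apply: le_ereal_inf_tmp => _ [r /= rM <-].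
have [Mr r1] : M < r /\ 1 < r by move: rM; rewrite gt_max => /andP[].
rewrite growth_ratio_ge ?ball_energy_ge0 //.
by apply: le_trans (H r r1) _; rewrite lee_fin HM.
Qed.

Lemma lower_fourier_decay_le (K b : R) : 0 < K ->
  (forall r, 1 < r -> ((K * r `^ b)%:E <= ball_energy mu theta^-1 r)%E) ->
  (lower_fourier_decay mu theta <= (theta * (1 - b))%:E)%E.
Proof.
move=> K0 H; apply/lee_addgt0Pr => e e0; rewrite -EFinD.
set x := _ + e.
have bx : 1 - x / theta < b.
  by rewrite ltrBlDl -ltrBlDr ltr_pdivlMr // /x mulrC; lra.
have Ki : 0 < K^-1 by rewrite invr_gt0.
have [M HM] := powR_dominates Ki bx.
rewrite lower_fourier_decayE; apply: ge_ereal_sup => _ [V [N [_ NV]] <-].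
(* The lower limit is a supremum of infima over neighbourhoods [V] of infinity, so one radius in
   each [V] is enough. *)
pose r := Num.max N (Num.max M 1) + 1.
have m1 : N <= Num.max N (Num.max M 1) by rewrite le_max lexx.
have m2 : M <= Num.max N (Num.max M 1) by rewrite !le_max lexx orbT.
have m3 : 1 <= Num.max N (Num.max M 1) by rewrite !le_max lexx !orbT.
have [Nr Mr r1] : [/\ N < r, M < r & 1 < r] by rewrite /r; split; lra.
apply: (@le_trans _ _ (theta%:E * lne (r^-1%:E * ball_energy mu theta^-1 r) *
   ((- ln r)^-1)%:E)%E).
  by apply: ereal_inf_lbound; exists r => //; exact: NV.
rewrite growth_ratio_le ?ball_energy_ge0 //.
apply: le_trans _ (H r r1); rewrite lee_fin -ler_pdivrMl //.
exact: HM.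
Qed.

Lemma fourier_energyE s : fourier_energy mu s theta =
  ((\int[leb]_(z in setT) (fourier_power mu z `^ theta^-1 *
     `|z| `^ (s / theta - 1))%:E) `^ theta)%E.
Proof.
rewrite /fourier_energy; under eq_integral do rewrite fourier_modulus_powR.
by [].
Qed.

Lemma measurable_energy_density s D : measurable D ->
  measurable_fun D (fun z : R => (fourier_power mu z `^ theta^-1 *
     `|z| `^ (s / theta - 1))%:E).
Proof.
move=> mD; apply/measurable_EFinP; apply: measurable_funTS.
apply: measurable_funM; first exact: measurableT_comp (measurable_powR _) mmu.
by apply: measurableT_comp (measurable_powR _) _; exact: normr_measurable.
Qed.

(** For [1 < |z| <= r] the weight [|z|^(s / theta - 1)] times [r^m] is at least 1, with [m] the
    exponent on the right. The maximum with 0 matters: for [s >= theta] it gives bounded ball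
    integrals. *)
Lemma ball_energy_of_fourier_energy s : (fourier_energy mu s theta < +oo)%E ->
  exists2 K, 0 < K & forall r, 1 <= r -> (ball_energy mu theta^-1 r <=
    (K * r `^ (Num.max 0 (1 - s / theta)))%:E)%E.
Proof.
have ti0 : 0 <= theta^-1 by rewrite invr_ge0 ltW.
rewrite fourier_energyE => /(lty_poweRy (lt0r_neq0 theta0)).
set J := (X in (X < _)%E) => Jy.
have J0 : (0 <= J)%E.
  by apply: integral_ge0 => z _; rewrite lee_fin mulr_ge0 // powR_ge0.
have Jf : J \is a fin_num by rewrite ge0_fin_numE.
(* 2 is the length of [[-1, 1]], where the integrand is bounded by 1; the energy integral [J] takes
   care of the rest. *)
exists (2 + fine J) => [|r r1].
  by apply: ltr_pwDl => //; exact: fine_ge0.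
set m := Num.max 0 (1 - s / theta).
have m0 : 0 <= m by rewrite /m le_max lexx.
have m1 : 1 - s / theta <= m by rewrite /m le_max lexx orbT.
have rm : 1 <= r `^ m.
  by apply: le_trans (_ : 1 `^ m <= _); [rewrite powR1|apply: ge0_ler_powR; rewrite ?nnegrE //; lra].
apply: (@le_trans _ _ (\int[leb]_(z in setT) (((\1_[set z : R | (`|z| <= 1)%R] z)%:E) +
   (r `^ m)%:E * (fourier_power mu z `^ theta^-1 * `|z| `^ (s / theta - 1))%:E))%E).
  rewrite /ball_energy integral_mkcond; apply: ge0_le_integral => //.
  - by move=> z _; apply: erestrict_ge0 => y _; rewrite lee_fin powR_ge0.
  - apply/(measurable_restrictT _ (measurable_sym r)).
    by apply: measurable_fourier_powR; exact: measurable_sym.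
  - apply: emeasurable_funD.
      by apply/measurable_EFinP; apply: measurable_indic; exact: measurable_sym.
    by apply: emeasurable_funM => //; exact: measurable_energy_density.
  - move=> z _; rewrite patchE; case: ifPn => [|_]; last first.
      by rewrite -EFinM -EFinD lee_fin addr_ge0 ?mulr_ge0 ?powR_ge0.
    rewrite inE /= => zr; rewrite -EFinM -EFinD lee_fin indicE.
    case: (boolP (_ \in _)) => [_|].
      rewrite -[leLHS]addr0 lerD ?fourier_powR_le1 //.
      by rewrite !mulr_ge0 ?powR_ge0.
    rewrite notin_setE /= => /negP; rewrite -ltNge => z1.
    rewrite add0r mulrCA -[leLHS]mulr1 ler_wpM2l ?powR_ge0 //.
    have z0 : 0 < `|z| by lra.
    have zm : `|z| `^ m <= r `^ m by apply: ge0_ler_powR; rewrite ?nnegrE //; lra.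
    apply: (@le_trans _ _ (`|z| `^ m * `|z| `^ (s / theta - 1))); last first.
      by rewrite ler_wpM2r ?powR_ge0.
    rewrite -powRD_pos //; apply: le_trans (_ : `|z| `^ 0 <= _); first by rewrite powRr0.
    by apply: ler_powR; lra.
rewrite ge0_integralD //; last 3 first.
- by apply/measurable_EFinP; apply: measurable_indic; exact: measurable_sym.
- by move=> z _; rewrite -EFinM lee_fin !mulr_ge0 ?powR_ge0.
- by apply: emeasurable_funM => //; exact: measurable_energy_density.
rewrite integral_indic_sym // ge0_integralZl_EFin //; last 3 first.
- by move=> z _; rewrite lee_fin mulr_ge0 ?powR_ge0.
- exact: measurable_energy_density.
- exact: powR_ge0.
rewrite -/J -(fineK Jf) -EFinM -EFinD lee_fin.
have : 0 <= fine J by exact: fine_ge0.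
move: rm; nra.
Qed.

(* The density is dominated termwise on dyadic annuli: inside the ball of radius
   [L] by the power of [|z|] alone, outside it through the growth hypothesis. *)
Lemma fourier_energy_lty (a s M : R) : 0 < s -> s < a ->
  (forall r, M < r -> 1 < r ->
    (ball_energy mu theta^-1 r <= (r `^ (1 - a / theta))%:E)%E) ->
  (fourier_energy mu s theta < +oo)%E.
Proof.
move: theta0 => th0 s0 sa HM.
have ti0 : 0 <= theta^-1 by rewrite invr_ge0 ltW.
rewrite fourier_energyE; apply: poweR_lty.
set e := s / theta - 1.
pose L := Num.max M 1 + 1.
have LM : M < L by rewrite /L ltr_pwDr // le_max lexx.
have L1 : 1 < L by rewrite /L ltr_pwDr // le_max lexx orbT.
have L0 : 0 < L by lra.
pose C : R := 2 `^ `|e|.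
have C0 : 0 < C by rewrite powR_gt0.
pose y k : R := L / 2 ^+ k.
pose Y k : R := L * 2 ^+ k.+1.
have p2 k : 0 < 2 ^+ k :> R by rewrite exprn_gt0.
have y0 k : 0 < y k by rewrite divr_gt0.
have Y0 k : 0 < Y k by rewrite mulr_gt0.
have LY k : L <= Y k by rewrite /Y ler_peMr ?(ltW L0) // exprn_ege1 // ler1n.
(* Balls stand in for the annuli: their overlaps only increase the majorant, and the growth
   hypothesis is about balls. *)
pose g1 k (z : R) : \bar R := ((C * y k `^ e)%:E * (\1_[set z : R | (`|z| <= y k)%R] z)%:E)%E.
pose g2 k (z : R) : \bar R := ((C * Y k `^ e)%:E *
  ((fun z => (fourier_power mu z `^ theta^-1)%:E) \_ [set z : R | (`|z| <= Y k)%R]) z)%E.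
have c1 k : 0 <= C * y k `^ e by rewrite mulr_ge0 ?powR_ge0 ?(ltW C0).
have c2 k : 0 <= C * Y k `^ e by rewrite mulr_ge0 ?powR_ge0 ?(ltW C0).
have g10 k z : (0 <= g1 k z)%E by rewrite mule_ge0 ?lee_fin.
have r0 k z : (0 <= ((fun z => (fourier_power mu z `^ theta^-1)%:E)
    \_ [set z : R | (`|z| <= Y k)%R]) z)%E.
  by apply: erestrict_ge0 => x _; rewrite lee_fin powR_ge0.
have g20 k z : (0 <= g2 k z)%E by rewrite mule_ge0 ?lee_fin.
have mr k : measurable_fun setT ((fun z => (fourier_power mu z `^ theta^-1)%:E)
    \_ [set z : R | `|z| <= Y k]).
  apply/(measurable_restrictT _ (measurable_sym _)).
  by apply: measurable_fourier_powR; exact: measurable_sym.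
have mg1 k : measurable_fun setT (g1 k).
  apply: emeasurable_funM => //.
  by apply/measurable_EFinP; apply: measurable_indic; exact: measurable_sym.
have mg2 k : measurable_fun setT (g2 k) by apply: emeasurable_funM.
have bound z : exists k, ((fourier_power mu z `^ theta^-1 * `|z| `^ e)%:E
    <= g1 k z + g2 k z)%E.
  have D0 : 0 <= fourier_power mu z `^ theta^-1 by exact: powR_ge0.
  have D1 : fourier_power mu z `^ theta^-1 <= 1 by exact: fourier_powR_le1.
  suff [k [H|H]] : exists k, (`|z| <= y k /\ `|z| `^ e <= C * y k `^ e) \/
      (`|z| <= Y k /\ `|z| `^ e <= C * Y k `^ e).
  - exists k; rewrite -[leLHS]adde0 leeD // /g1 indicE mem_set ?mule1; last exact: H.1.
    rewrite lee_fin (le_trans _ H.2) // ler_piMl // powR_ge0.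
  - exists k; rewrite -[leLHS]add0e leeD // /g2 patchE mem_set; last exact: H.1.
    by rewrite -EFinM lee_fin mulrC ler_wpM2r //; exact: H.2.
  (* At 0 the weight has the default value of the power, 1 if [e = 0] and 0 otherwise; the inner
     term of index 0 covers both. *)
  have [z0|z0] := eqVneq z 0.
    exists 0%N; left; rewrite z0 normr0; split; first exact: ltW.
    rewrite /C; have [->|e0] := eqVneq e 0; first by rewrite normr0 !powRr0 mulr1.
    by rewrite powR0.
  have nz : 0 < `|z| by rewrite normr_gt0.
  case: (leP `|z| L) => zL.
    have [k /andP[k1 k2]] : exists k, 2 ^+ k <= L / `|z| < 2 ^+ k.+1.
      by apply: dyadic_scale; rewrite ler_pdivlMr // mul1r.
    exists k; left.
    have zy : `|z| <= y k.
      by rewrite /y ler_pdivlMr // mulrC -ler_pdivlMr.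
    split=> //; apply: powR_dyadic_comparable => //.
    move: k2; rewrite ltr_pdivrMr // exprS /y => k2.
    by rewrite -mulrA -invfM ler_pdivrMr ?mulr_gt0 //; lra.
  have [k /andP[k1 k2]] : exists k, 2 ^+ k <= `|z| / L < 2 ^+ k.+1.
    by apply: dyadic_scale; rewrite ler_pdivlMr // mul1r ltW.
  exists k; right.
  have zY : `|z| <= Y k.
    by move: k2; rewrite ltr_pdivrMr // /Y mulrC => /ltW.
  split=> //; apply: powR_dyadic_comparable => //.
  by move: k1; rewrite ler_pdivlMr // /Y exprS; lra.
apply: (@le_lt_trans _ _ (\int[leb]_z (\sum_(0 <= k <oo) (g1 k z + g2 k z)))%E).
  apply: ge0_le_integral => //.
  - by move=> z _; rewrite lee_fin mulr_ge0 ?powR_ge0.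
  - exact: measurable_energy_density.
  - apply: ge0_emeasurable_sum => [k z _ _|k _]; first by rewrite adde_ge0.
    by apply: emeasurable_funD; [exact: mg1|exact: mg2].
  - move=> z _; have [k Hk] := bound z; apply: le_trans Hk _.
    apply: le_trans (nneseries_lim_ge k.+1 _); last by move=> n _ _; rewrite adde_ge0.
    rewrite big_nat_recr //= -[leLHS]add0e leeD // sume_ge0 // => n _.
    by rewrite adde_ge0.
rewrite integral_nneseries //; last 2 first.
- by move=> k; apply: emeasurable_funD; [exact: mg1|exact: mg2].
- by move=> k z _; rewrite adde_ge0.
(* Inner terms are of order [y k ^ (s / theta)] and outer ones of order [Y k ^ ((s - a) / theta)];
   these are the ratios of the two geometric series, below 1 because [0 < s < a]. *)
pose q1 : R := 2 `^ (- (s / theta)).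
pose q2 : R := 2 `^ ((s - a) / theta).
pose q := Num.max q1 q2.
have powlt1 (x : R) : x < 0 -> 2 `^ x < 1.
  move=> x0; rewrite /powR gt_eqF // -[ltRHS]expR0 ltr_expR pmulr_llt0 //.
  by rewrite ln_gt0 // ltr1n.
have q11 : q1 < 1 by apply: powlt1; rewrite oppr_lt0 divr_gt0.
have q21 : q2 < 1 by apply: powlt1; rewrite pmulr_llt0 ?invr_gt0 // subr_lt0.
have q10 : 0 < q1 by rewrite powR_gt0.
have q20 : 0 < q2 by rewrite powR_gt0.
have q0 : 0 < q by rewrite /q lt_max q10.
have ql1 : q < 1 by rewrite /q gt_max q11.
pose K := C * (2 * L `^ (s / theta) + L `^ ((s - a) / theta)).
have K0 : 0 <= K by rewrite mulr_ge0 ?(ltW C0) // addr_ge0 ?mulr_ge0 ?powR_ge0.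
apply: (@le_lt_trans _ _ (K / (1 - q))%:E); last by rewrite ltry.
apply: nneseries_geometric_le => // k.
  by apply: integral_ge0 => z _; rewrite adde_ge0.
have I1 : (\int[leb]_z g1 k z = (C * y k `^ e)%:E * (2 * y k)%:E)%E.
  rewrite /g1 ge0_integralZl_EFin // ?integral_indic_sym ?(ltW (y0 k)) //.
  by apply/measurable_EFinP; apply: measurable_indic; exact: measurable_sym.
have I2 : (\int[leb]_z g2 k z = (C * Y k `^ e)%:E * ball_energy mu theta^-1 (Y k))%E.
  rewrite /g2 ge0_integralZl_EFin //; last exact: mr.
  congr (_ * _)%E.
  by rewrite /ball_energy [RHS]integral_mkcond.
apply: (@le_trans _ _ ((C * y k `^ e)%:E * (2 * y k)%:E +
    (C * Y k `^ e)%:E * ball_energy mu theta^-1 (Y k))%E).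
  rewrite ge0_integralD //; [|exact: mg1|exact: mg2].
  by apply: leeD; [rewrite -[leRHS]I1|rewrite -[leRHS]I2].
have YE : (ball_energy mu theta^-1 (Y k) <= (Y k `^ (1 - a / theta))%:E)%E.
  apply: HM; first exact: lt_le_trans LM (LY k).
  exact: lt_le_trans L1 (LY k).
apply: (@le_trans _ _ ((C * y k `^ e)%:E * (2 * y k)%:E +
    (C * Y k `^ e)%:E * (Y k `^ (1 - a / theta))%:E)%E).
  by apply: leeD => //; apply: lee_wpmul2l => //; rewrite lee_fin; exact: c2.
rewrite -!EFinM -EFinD lee_fin.
have E1 : C * y k `^ e * (2 * y k) = C * 2 * L `^ (s / theta) * q1 ^+ k.
  have -> : C * y k `^ e * (2 * y k) = C * 2 * y k `^ (s / theta).
    rewrite (_ : s / theta = e + 1); last by rewrite /e subrK.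
    by rewrite (powRD_pos e 1 (y0 k)) powRr1 ?(ltW (y0 k)) //; ring.
  rewrite /y powRM ?invr_ge0 ?(ltW L0) ?(ltW (p2 k)) // /q1.
  rewrite powR_pow2 mulrA; congr (_ * _).
  by rewrite /powR gt_eqF // -expRM_natl; congr expR; ring.
(* Only an inequality, as [Y k] carries [2 ^+ k.+1]: the extra factor [q2 < 1] is dropped. *)
have E2 : C * Y k `^ e * Y k `^ (1 - a / theta) <= C * L `^ ((s - a) / theta) * q2 ^+ k.
  rewrite -mulrA -powRD_pos //.
  rewrite (_ : e + (1 - a / theta) = (s - a) / theta); last first.
    by rewrite /e mulrBl; ring.
  rewrite -mulrA ler_pM2l // /Y powRM ?(ltW L0) ?(ltW (p2 k.+1)) //.
  rewrite ler_wpM2l ?powR_ge0 //.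
  by rewrite powR_exprn // exprS -/q2 ler_piMl ?exprn_ge0 // ltW.
rewrite E1; apply: le_trans (lerD (lexx _) E2) _.
have qk1 : q1 ^+ k <= q ^+ k.
  by apply: lerXn2r; rewrite ?nnegrE ?(ltW q10) ?(ltW q0) // /q le_max lexx.
have qk2 : q2 ^+ k <= q ^+ k.
  by apply: lerXn2r; rewrite ?nnegrE ?(ltW q20) ?(ltW q0) // /q le_max lexx orbT.
rewrite (_ : K * q ^+ k = C * 2 * L `^ (s / theta) * q ^+ k +
  C * L `^ ((s - a) / theta) * q ^+ k); last by rewrite /K; ring.
by apply: lerD; rewrite ler_wpM2l // !mulr_ge0 ?powR_ge0 ?(ltW C0).
Qed.

(** For [s] below the lower limit, an [a] strictly between the two is a decay exponent for all large
    radii, and the gap [a - s] makes the energy at [s] converge. The infinite and nonpositive values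
    are treated apart. *)
Lemma lower_fourier_decay_le_spectrum :
  (lower_fourier_decay mu theta <= fourier_spectrum mu theta)%E.
Proof.
have key (s : R) : 0 < s -> (s%:E < lower_fourier_decay mu theta)%E ->
    (s%:E <= fourier_spectrum mu theta)%E.
  move=> s0 sF.
  have [a sa aF] : exists2 a : R, s < a & (a%:E < lower_fourier_decay mu theta)%E.
    case: (lower_fourier_decay mu theta) sF => [F| |] //.
      rewrite lte_fin => sF; exists ((s + F) / 2); rewrite ?lte_fin; lra.
    by move=> _; exists (s + 1); rewrite ?ltry //; lra.
  rewrite /fourier_spectrum le_max; apply/orP; right.
  apply: ereal_sup_ge; exists s%:E => //; exists s => //; split; first exact: ltW.
  move: aF; rewrite lower_fourier_decayE => /ereal_sup_gt[_ [V [N [_ NV]] <-] aV].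
  apply: (@fourier_energy_lty a s N) => // r Nr r1.
  rewrite -growth_ratio_ge ?ball_energy_ge0 //.
  apply: le_trans (ltW aV) _; apply: ereal_inf_lbound.
  by exists r => //; exact: NV.
case: (leP (lower_fourier_decay mu theta) 0%E) => F0.
  by apply: le_trans F0 _; rewrite /fourier_spectrum le_max lexx.
have S0 : (0 <= fourier_spectrum mu theta)%E by rewrite /fourier_spectrum le_max lexx.
move: key F0; case: (lower_fourier_decay mu theta) => [F| |] // key F0.
  apply/lee_subgt0Pr => e e0; rewrite -EFinB.
  case: (leP (F - e) 0) => Fe; first by apply: le_trans S0; rewrite lee_fin.
  by apply: key => //; rewrite lte_fin; lra.
rewrite leye_eq; apply/eqP; apply/eqyP => A A0; apply: key => //.
exact: ltry.
Qed.

End Generic.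

(** * Hausdorff dimension *)

Lemma ediam_set0 (R : realType) : ediam (@set0 R) = -oo%E.
Proof. by rewrite /ediam set0X image_set0 ereal_sup0. Qed.

Lemma ediam_ge0 (R : realType) (U : set R) x : U x -> (0 <= ediam U)%E.
Proof.
by move=> Ux; apply: ereal_sup_ubound; exists (x, x) => //=; rewrite subrr normr0.
Qed.

Lemma ediam_itv_le (R : realType) (a b : R) : (ediam `[a, b] <= (b - a)%:E)%E.
Proof.
apply: ge_ereal_sup => _ [[x y] /= [Hx Hy] <-].
move: Hx Hy; rewrite !in_itv /= => /andP[ax xb] /andP[ay yb].
by rewrite lee_fin ler_norml; apply/andP; split; lra.
Qed.

Lemma dist_le_ediam (R : realType) (U : set R) (d x y : R) :
  (ediam U <= d%:E)%E -> U x -> U y -> `|x - y| <= d.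
Proof.
move=> Ud Ux Uy; rewrite -lee_fin; apply: le_trans Ud.
by apply: ereal_sup_ubound; exists (x, y).
Qed.

Lemma hausdorff_gauge_ge0 (R : realType) (s : R) (U : set R) :
  (0 <= hausdorff_gauge s U)%E.
Proof. by rewrite /hausdorff_gauge; case: ifP => // _; exact: poweR_ge0. Qed.

Lemma hausdorff_premeasure_ge0 (R : realType) (s delta : R) (E : set R) :
  (0 <= hausdorff_premeasure s delta E)%E.
Proof.
apply: le_ereal_inf_tmp => _ [U _ <-]; apply: nneseries_ge0 => n _ _.
exact: hausdorff_gauge_ge0.
Qed.

Lemma digit_sum_weight (R : realType) (p c : R) n j : 0 < p < 1 ->
  digit_sum (c + ln p) (c + ln (1 - p)) n j = n%:R * c + ln (digit_weight p n j).
Proof.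
move=> p01; have /andP[p0 p1] := p01.
elim: n j => [|n IH] j /=; first by rewrite mul0r ln1 addr0.
rewrite lnM ?posrE ?digit_weight_gt0 //; last by case: ifP => _ //; lra.
by rewrite IH -natr1 mulrDl mul1r; case: ifP => _; ring.
Qed.

Lemma digit_sumN (R : realType) (a b : R) n j :
  digit_sum (- a) (- b) n j = - digit_sum a b n j.
Proof.
by elim: n j => [|n IH] j /=; [rewrite oppr0|rewrite IH opprD; case: ifP].
Qed.

(** Encodes an index at distance at most 2 from [j] as [j + k - 2] with [k < 5], the truncated
    subtractions being exact here. *)
Lemma nat_offset (i j : nat) : (i <= j + 2)%N -> (j <= i + 2)%N ->
  (i + 2 - j < 5)%N /\ (j + (i + 2 - j) - 2 = i)%N.
Proof. by lia. Qed.

Section HausdorffDimension.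
Context (R : realType) (p : R) (d : measure_display) (T : measurableType d)
  (P : probability T R) (X : nat -> {RV P >-> R}) (Y : {RV P >-> R}).
Hypotheses (hp0 : 0 < p) (hp1 : p < 1) (hX : mutually_independent X)
  (hX0 : forall n, P (X n @^-1` [set 0]) = p%:E)
  (hX1 : forall n, P (X n @^-1` [set 1]) = (1 - p)%:E)
  (hS : {ae P, forall w,
       series (fun n => X n w * (1 / 2) ^+ n.+1) @ \oo --> Y w}).

Local Notation J n w := (dyadic_index (fun k => X k w) n).
Local Notation mu := (distribution P Y).
Local Notation entropy := ((p * ln p + (1 - p) * ln (1 - p)) / (- ln 2)).

Let ln2 : 0 < ln 2 :> R. Proof. by rewrite ln_gt0 // ltr1n. Qed.

Let p01 : 0 < p < 1. Proof. by rewrite hp0 hp1. Qed.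

Lemma entropyE : entropy * ln 2 = - (p * ln p + (1 - p) * ln (1 - p)).
Proof. by rewrite invrN mulrN mulNr divfK // gt_eqF. Qed.

Lemma entropy_gt0 : 0 < entropy.
Proof.
rewrite -(pmulr_lgt0 _ ln2) entropyE oppr_gt0.
have l1 : ln p < 0 by rewrite ln_lt0 // hp0 hp1.
have l2 : ln (1 - p) < 0.
  by rewrite ln_lt0 //; move: hp0 hp1 => ? ?; apply/andP; split; lra.
by move: hp0 hp1 => ? ?; nra.
Qed.

Definition typical_set (a b : R) (n : nat) : set R :=
  \bigcup_(j in [set j | (j < 2 ^ n)%N /\ digit_sum a b n j < 0])
     `[(j%:R / 2 ^+ n), (j.+1%:R / 2 ^+ n)]%classic.

Lemma measurable_typical_set a b n : measurable (typical_set a b n).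
Proof. by apply: bigcup_measurable => j _; exact: measurable_itv. Qed.

(** With these steps the condition on the digit sum says that the interval has weight above
    [2 ^ (- n s')]. The count goes through the weights: the gauge [2 ^ (- n s)] is at most the
    weight times [2 ^ (n (s' - s))], and the weights sum to 1. *)
Lemma hausdorff_premeasure_typical s s' delta n (E : set R) :
  E `<=` typical_set (- (s' * ln 2 + ln p)) (- (s' * ln 2 + ln (1 - p))) n ->
  0 <= s -> (2 ^+ n)^-1 <= delta ->
  (hausdorff_premeasure s delta E <= (expR (n%:R * ((s' - s) * ln 2)))%:E)%E.
Proof.
set a := - _; set b := - (_ + ln (1 - p)) => EF s0 nd.
pose good j := (j < 2 ^ n)%N && (digit_sum a b n j < 0).
(* Discarded indices get the empty set, whose gauge is 0 and whose diameter [-oo] satisfies every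
   bound. *)
pose U (i : nat) : set R :=
  if good i then `[(i%:R / 2 ^+ n), (i.+1%:R / 2 ^+ n)]%classic else set0.
have p2 : 0 < 2 ^+ n :> R by rewrite exprn_gt0.
have dU i : good i -> (ediam (U i) <= ((2 ^+ n)^-1)%:E)%E.
  move=> gi; rewrite /U gi; apply: le_trans (ediam_itv_le _ _) _.
  by rewrite -natr1 mulrDl mul1r addrAC subrr add0r.
apply: (@le_trans _ _ (\sum_(0 <= i <oo) hausdorff_gauge s (U i))%E).
  apply: ereal_inf_lbound; exists U => //; split.
    move=> x /EF[j [jn j0] xj]; exists j => //.
    by rewrite /U /good jn j0.
  move=> i; case: (boolP (good i)) => gi.
    by apply: le_trans (dU i gi) _; rewrite lee_fin.
  by rewrite /U (negbTE gi) ediam_set0 leNye.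
have gU i : (hausdorff_gauge s (U i) <=
    (if (i < 2 ^ n)%N then digit_weight p n i * expR (n%:R * ((s' - s) * ln 2)) else 0)%:E)%E.
  case: (boolP (good i)) => gi; last first.
    rewrite /U (negbTE gi) /hausdorff_gauge eqxx lee_fin; case: ifP => // _.
    by rewrite mulr_ge0 ?expR_ge0 // ltW // digit_weight_gt0.
  have /andP[i2 i0] := gi; rewrite i2.
  have Ui : U i (i%:R / 2 ^+ n).
    by rewrite /U gi /= in_itv /= lexx ler_wpM2r ?invr_ge0 ?(ltW p2) // ler_nat.
  rewrite /hausdorff_gauge ifF; last first.
    by apply/negbTE/set0P; exists (i%:R / 2 ^+ n).
  have := dU i gi; have := ediam_ge0 Ui.
  case: (ediam (U i)) => [D| |] //; rewrite !lee_fin => D0 Dn.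
  apply: (@le_trans _ _ ((2 ^+ n)^-1 `^ s)).
    by apply: ge0_ler_powR; rewrite ?nnegrE ?invr_ge0 ?(ltW p2).
  rewrite powR_pow2 -[digit_weight p n i]lnK ?posrE ?digit_weight_gt0 // -expRD ler_expR.
  move: i0; rewrite /a /b digit_sumN digit_sum_weight //; lra.
apply: (@le_trans _ _ (\sum_(0 <= i <oo) (if (i < 2 ^ n)%N then
    digit_weight p n i * expR (n%:R * ((s' - s) * ln 2)) else 0)%:E)%E).
  apply: lee_nneseries => [i _ _|i _]; last exact: gU.
  exact: hausdorff_gauge_ge0.
rewrite (@nneseries_split _ _ _ (2 ^ n)%N) //; last first.
  move=> i _; rewrite lee_fin; case: ifP => // _.
  by rewrite mulr_ge0 ?expR_ge0 // ltW // digit_weight_gt0.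
rewrite [X in (_ + X)%E]eseries0 ?adde0; last first.
  by move=> i; rewrite add0n => H _; rewrite ltnNge H.
rewrite add0n sumEFin lee_fin big_mkord.
under eq_bigr do rewrite ltn_ord.
by rewrite -mulr_suml sum_digit_weight mul1r.
Qed.

(** The points lying in a heavy interval at every level from [N] on form a set of positive measure.
    At exponent [s > s'] the covers by heavy intervals have total gauge tending to 0. *)
Lemma hausdorff_dim_measure_le s : entropy < s ->
  (hausdorff_dim_measure mu <= s%:E)%E.
Proof.
move=> hs; pose s' := (entropy + s) / 2.
have [hs' ss'] : entropy < s' /\ s' < s by rewrite /s'; split; lra.
have s0 : 0 < s by apply: lt_trans hs; exact: entropy_gt0.
pose a := - (s' * ln 2 + ln p); pose b := - (s' * ln 2 + ln (1 - p)).
have mab : p * a + (1 - p) * b < 0.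
  have -> : p * a + (1 - p) * b = (entropy - s') * ln 2.
    by rewrite [RHS]mulrBl entropyE /a /b; ring.
  by rewrite pmulr_llt0 // subr_lt0.
have half0 : 0 < 1 / 2 :> R by lra.
have [N HN] := prob_tail_events_small hp0 hp1 hX hX1 mab half0.
pose E := \bigcap_n typical_set a b (N + n)%N.
have mE : measurable E.
  by apply: bigcapT_measurable => n; exact: measurable_typical_set.
have E0 : (0 < mu E)%E.
  have [Z [mZ PZ subZ]] := ae_dyadic_bounds hX0 hX1 hS.
  have mT : measurable (\bigcup_n tail_event X a b (N + n)%N).
    by apply: bigcup_measurable => n _; exact: measurable_tail_event.
  have mY : measurable (Y @^-1` E).
    by rewrite -[_ @^-1` _]setTI; apply: measurable_funP.
  (* Off [Z] and the late tail events, the interval of index [J (N + n) w] is heavy and contains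
     [Y w], for every [n]. So [mu E = 0] would leave total probability at most 1/2. *)
  have cov : [set: T] `<=` (Y @^-1` E `|` \bigcup_n tail_event X a b (N + n)%N) `|` Z.
    move=> w _; case: (pselect (Z w)) => [|nZ]; first by right.
    left; case: (pselect ((\bigcup_n tail_event X a b (N + n)%N) w)) => [|nt]; first by right.
    left => n _.
    have [_ Hw] : (forall n, X n w = 0 \/ X n w = 1) /\
       forall n, (J n w)%:R / 2 ^+ n <= Y w <= (J n w).+1%:R / 2 ^+ n.
      by apply: contrapT => H; apply: nZ; exact: subZ.
    exists (J (N + n)%N w); last by rewrite /= in_itv /=; exact: Hw.
    split; first exact: dyadic_index_lt.
    by rewrite ltNge; apply/negP => H; apply: nt; exists n.
  rewrite lt0e measure_ge0 andbT; apply/eqP => muE0.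
  have : (P [set: T] <= (1 / 2)%:E)%E.
    apply: le_trans (le_measure _ _ _ cov) _; rewrite ?inE //.
      by apply: measurableU => //; exact: measurableU.
    apply: (@le_trans _ _ (P (Y @^-1` E `|` \bigcup_n tail_event X a b (N + n)%N) + P Z)%E).
      by apply: measureU2 => //; exact: measurableU.
    have -> : P Z = 0%E by exact: PZ.
    rewrite adde0.
    apply: (@le_trans _ _ (P (Y @^-1` E) + P (\bigcup_n tail_event X a b (N + n)%N))%E).
      exact: measureU2.
    have -> : P (Y @^-1` E) = 0%E by exact: muE0.
    by rewrite add0e.
  by rewrite probability_setT lee_fin; lra.
apply: ereal_inf_le; exists (hausdorff_dim E); first by exists E.
apply: ereal_inf_lbound; exists s => //; split; first exact: ltW.
apply/eqP; rewrite eq_le; apply/andP; split; last first.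
  apply: le_trans (hausdorff_premeasure_ge0 s 1 E) _.
  by apply: ereal_sup_ubound; exists 1 => //=.
apply: ge_ereal_sup => _ [delta /= delta0 <-].
apply/lee_addgt0Pr => e e0; rewrite add0e.
pose q : R := expR ((s' - s) * ln 2).
have q0 : 0 < q by exact: expR_gt0.
have q1 : q < 1.
  by rewrite /q -[ltRHS]expR0 ltr_expR pmulr_llt0 // subr_lt0.
have [n [n1 n2]] : exists n, q ^+ (N + n) <= e /\ (2 ^+ (N + n))^-1 <= delta.
  have cv (r eps : R) : 0 < r -> r < 1 -> 0 < eps -> \forall n \near \oo, r ^+ n <= eps.
    move=> r0 r1 eps0; have nr : `|r| < 1 by rewrite gtr0_norm.
    have := cvg_geometric 1 nr => /cvgrPdist_le /(_ eps eps0).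
    apply: filterS => n /=.
    by rewrite sub0r normrN mul1r ger0_norm // exprn_ge0 // ltW.
  have h0 : 0 < 1 / 2 :> R by lra.
  have h1 : 1 / 2 < 1 :> R by lra.
  have [n1 _ H1] := cv _ _ q0 q1 e0.
  have [n2 _ H2] := cv _ _ h0 h1 delta0.
  exists (maxn n1 n2); split.
    by apply: H1 => /=; apply: leq_trans (leq_maxl _ _) (leq_addl _ _).
  have := H2 (N + maxn n1 n2)%N; rewrite /= expr_div_n expr1n div1r; apply.
  by apply: leq_trans (leq_maxr _ _) (leq_addl _ _).
apply: le_trans (@hausdorff_premeasure_typical s s' delta (N + n) E _ (ltW s0) n2) _.
  by move=> x Ex; exact: Ex.
by rewrite lee_fin expRM_natl.
Qed.

Lemma prob_index_event_le n j :
  (P (index_event X n j) <= (digit_weight p n j)%:E)%E.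
Proof.
case: (ltnP j (2 ^ n)) => jn; first by rewrite (prob_index_event hX hX1 jn).
rewrite (_ : index_event X n j = set0) ?measure0 ?lee_fin ?digit_weight_ge0 ?(ltW hp0) ?(ltW hp1) //.
apply/seteqP; split=> // w; rewrite /index_event /= => Jj.
by have := dyadic_index_lt (fun k => X k w) n; rewrite Jj ltnNge jn.
Qed.

(* Two points of [U] differ by at most [2 ^- n], so their indices differ by at
   most 2: five cylinders of level [n] suffice. *)
Lemma cylinder_cover (G : set T) (U : set R) (n : nat) (c : R) : 0 <= c ->
  (forall w, G w -> (J n w)%:R / 2 ^+ n <= Y w <= (J n w).+1%:R / 2 ^+ n) ->
  (forall w, G w -> digit_weight p n (J n w) <= c) ->
  (ediam U <= ((2 ^+ n)^-1)%:E)%E ->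
  exists V, [/\ measurable V, G `&` Y @^-1` U `<=` V & (P V <= (5 * c)%:E)%E].
Proof.
move=> c0 GY Gc Un.
have [[w0 [Gw0 Uw0]]|] := pselect (exists w, (G `&` Y @^-1` U) w); last first.
  move=> H; exists set0; split=> //; last by rewrite measure0 lee_fin mulr_ge0.
  by move=> w Gw; exfalso; apply: H; exists w.
pose j0 := J n w0.
pose V i := if digit_weight p n (j0 + i - 2) <= c then index_event X n (j0 + i - 2) else set0.
have mV i : measurable (V i).
  by rewrite /V; case: ifP => // _; exact: measurable_index_event.
exists (\big[setU/set0]_(i < 5) V i); split.
- exact: bigsetU_measurable.
- move=> w [Gw Uw].
  have p2 : 0 < 2 ^+ n :> R by rewrite exprn_gt0.
  have dY := dist_le_ediam Un Uw Uw0.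
  have /andP[l1 u1] := GY _ Gw; have /andP[l0 u0] := GY _ Gw0.
  have S m : m.+1%:R = m%:R + 1 :> R by rewrite natr1.
  move: l1 u1 l0 u0 dY; rewrite -/j0 (S j0) (S (J n w)).
  rewrite !ler_pdivrMr // !ler_pdivlMr // => l1 u1 l0 u0.
  rewrite ler_norml => /andP[d1 d2].
  have {}d2 : Y w * 2 ^+ n - Y w0 * 2 ^+ n <= 1.
    by rewrite -mulrBl -ler_pdivlMr // div1r.
  have {}d1 : -1 <= Y w * 2 ^+ n - Y w0 * 2 ^+ n.
    by rewrite -mulrBl -ler_pdivrMr // mulN1r.
  have h1 : (J n w)%:R <= (j0 + 2)%:R :> R by rewrite natrD; lra.
  have h2 : j0%:R <= (J n w + 2)%:R :> R by rewrite natrD; lra.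
  rewrite !ler_nat in h1 h2.
  have [i5 iE] := nat_offset h1 h2.
  rewrite -bigcup_mkord; exists (J n w + 2 - j0)%N => //=.
  have -> : V (J n w + 2 - j0)%N = index_event X n (J n w).
    by rewrite /V iE Gc.
  by [].
- apply: le_trans (Boole_inequality _ _) _; first by move=> i _; exact: mV.
  apply: (@le_trans _ _ (\sum_(i < 5) c%:E)%E); last first.
    by rewrite sumEFin sumr_const card_ord lee_fin mulr_natl.
  apply: lee_sum => i _; rewrite /V; case: ifP => [H|_]; last by rewrite measure0 lee_fin.
  by apply: le_trans (prob_index_event_le _ _) _; rewrite lee_fin.
Qed.

Lemma hausdorff_measure_neq0 s (E : set R) : measurable E -> (0 < mu E)%E ->
  0 <= s -> s < entropy -> hausdorff_measure s E != 0%E.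
Proof.
move=> mE E0 s0 hs; pose s' := (entropy + s) / 2.
have [hs' ss'] : s' < entropy /\ s < s' by rewrite /s'; split; lra.
pose a := s' * ln 2 + ln p; pose b := s' * ln 2 + ln (1 - p).
have mab : p * a + (1 - p) * b < 0.
  have -> : p * a + (1 - p) * b = (s' - entropy) * ln 2.
    by rewrite [RHS]mulrBl entropyE /a /b; ring.
  by rewrite pmulr_llt0 // subr_lt0.
have mY : measurable (Y @^-1` E).
  by rewrite -[_ @^-1` _]setTI; apply: measurable_funP.
pose m := fine (P (Y @^-1` E)).
have PE : P (Y @^-1` E) = m%:E.
  by rewrite fineK // fin_num_measure.
have m0 : 0 < m by rewrite -lte_fin -PE.
have half0 : 0 < m / 2 by rewrite divr_gt0.
have [N HN] := prob_tail_events_small hp0 hp1 hX hX1 mab half0.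
have [Z [mZ PZ subZ]] := ae_dyadic_bounds hX0 hX1 hS.
have mT : measurable (\bigcup_n tail_event X a b (N + n)%N).
  by apply: bigcup_measurable => n _; exact: measurable_tail_event.
pose G := (Y @^-1` E `\` \bigcup_n tail_event X a b (N + n)%N) `\` Z.
have mG : measurable G by apply: measurableD => //; exact: measurableD.
have PG : ((m / 2)%:E <= P G)%E.
  have H : (P (Y @^-1` E) <= P G + P (\bigcup_n tail_event X a b (N + n)%N) + P Z)%E.
    apply: (@le_trans _ _ (P (G `|` \bigcup_n tail_event X a b (N + n)%N `|` Z))%E).
      apply: le_measure; rewrite ?inE //.
        by apply: measurableU => //; exact: measurableU.
      move=> w Ew; case: (pselect (Z w)) => [|nZ]; first by right.
      left; case: (pselect ((\bigcup_n tail_event X a b (N + n)%N) w)) => [|nt]; first by right.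
      by left.
    apply: (@le_trans _ _ (P (G `|` \bigcup_n tail_event X a b (N + n)%N) + P Z)%E).
      by apply: measureU2 => //; exact: measurableU.
    by apply: leeD => //; exact: measureU2.
  have PZ' : P Z = 0%E by exact: PZ.
  have PGf : P G \is a fin_num by exact: fin_num_measure.
  have H' : (m%:E <= P G + (m / 2)%:E)%E.
    by rewrite -PE; apply: le_trans H _; rewrite PZ' adde0 leeD.
  rewrite -(fineK PGf) in H' *; move: H'; rewrite -EFinD !lee_fin; lra.
have GY w n : G w -> (J n w)%:R / 2 ^+ n <= Y w <= (J n w).+1%:R / 2 ^+ n.
  move=> [_ nZ].
  have [_ Hw] : (forall n, X n w = 0 \/ X n w = 1) /\
     forall n, (J n w)%:R / 2 ^+ n <= Y w <= (J n w).+1%:R / 2 ^+ n.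
    by apply: contrapT => H; apply: nZ; exact: subZ.
  exact: Hw.
have Gc w n : G w -> digit_weight p (N + n) (J (N + n) w) <= ((2 ^+ (N + n))^-1) `^ s'.
  move=> [[_ nt] _].
  have : digit_sum a b (N + n) (J (N + n)%N w) < 0.
    by rewrite ltNge; apply/negP => H; apply: nt; exists n.
  rewrite /a /b digit_sum_weight // powR_pow2 => H.
  by rewrite -[leLHS]lnK ?posrE ?digit_weight_gt0 // ler_expR; lra.
(* 5 counts the cylinders of [cylinder_cover]; [2 ^ s] pays for rounding a diameter up to a dyadic
   scale. *)
pose K : R := 5 * 2 `^ s.
have K0 : 0 < K by rewrite mulr_gt0 // powR_gt0.
have p2 n : 0 < 2 ^+ n :> R by rewrite exprn_gt0.
have cover n (U : set R) : (ediam U <= ((2 ^+ (N + n))^-1)%:E)%E ->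
    exists V, [/\ measurable V, G `&` Y @^-1` U `<=` V &
      (P V <= (5 * ((2 ^+ (N + n))^-1) `^ s')%:E)%E].
  apply: cylinder_cover; first exact: powR_ge0.
  - by move=> w Gw; exact: GY.
  - by move=> w Gw; exact: Gc.
(* The sets of a cover need not be measurable, so the part of [G] over [U] is enclosed in a
   measurable [V]. *)
have mass (U : set R) : (ediam U <= ((2 ^+ N)^-1)%:E)%E ->
    exists V, [/\ measurable V, G `&` Y @^-1` U `<=` V &
      (P V <= K%:E * hausdorff_gauge s U)%E].
  have [->|U0] := eqVneq U set0.
    move=> _; exists set0; split; [exact: measurable0|by move=> w []|].
    by rewrite measure0 mule_ge0 ?hausdorff_gauge_ge0 // lee_fin ltW.
  move=> UN; rewrite /hausdorff_gauge (negbTE U0).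
  have /set0P[x Ux] := U0.
  have := ediam_ge0 Ux; move: (UN); case ED : (ediam U) => [D| |] //.
  rewrite !lee_fin => DN; rewrite le_eqVlt => /orP[/eqP D0|D0].
    (* A set of diameter 0 is covered at every level; the intersection of these covers is null,
       whether its gauge is 0 or, for [s = 0], 1. *)
    have /choice[V HV] : forall n, exists V, [/\ measurable V, G `&` Y @^-1` U `<=` V &
        (P V <= (5 * ((2 ^+ (N + n))^-1) `^ s')%:E)%E].
      by move=> n; apply: cover; rewrite ED -D0 lee_fin invr_ge0 ltW.
    have mV : measurable (\bigcap_n V n).
      by apply: bigcapT_measurable => n; have [] := HV n.
    exists (\bigcap_n V n); split=> //.
      by move=> w Hw n _; have [_ + _] := HV n; apply.
    rewrite (_ : P _ = 0%E) ?mule_ge0 ?poweR_ge0 ?lee_fin ?(ltW K0) //.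
    apply/eqP; rewrite eq_le measure_ge0 andbT; apply/lee_addgt0Pr => e e0; rewrite add0e.
    pose q : R := expR (- (s' * ln 2)).
    have q0 : 0 < q by exact: expR_gt0.
    have q1 : q < 1.
      by rewrite /q -[ltRHS]expR0 ltr_expR oppr_lt0 mulr_gt0 //; lra.
    have nq : `|q| < 1 by rewrite gtr0_norm.
    have e5 : 0 < e / 5 by rewrite divr_gt0.
    have := cvg_geometric 1 nq => /cvgrPdist_le /(_ _ e5)[n _ /(_ (N + n)%N)].
    rewrite /= leq_addl => /(_ isT); rewrite sub0r normrN mul1r ger0_norm; last exact: exprn_ge0 (ltW q0).
    rewrite ler_pdivlMr // mulrC => qn.
    have [mVn _ PVn] := HV n.
    apply: le_trans (le_measure P _ _ (_ : \bigcap_n V n `<=` V n)) _; rewrite ?inE //.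
      by move=> w; apply.
    apply: le_trans PVn _; rewrite lee_fin powR_pow2 -mulrA -mulrN expRM_natl.
    exact: qn.
  (* That is, [D <= 2 ^ (- (N + k)) < 2 D]: level [N + k] covers [U], at a scale comparable to its
     diameter. *)
  have [k /andP[k1 k2]] : exists k, 2 ^+ k <= (2 ^+ N)^-1 / D < 2 ^+ k.+1.
    by apply: dyadic_scale; rewrite ler_pdivlMr // mul1r.
  have [|V [mV GV PV]] := cover k U.
    move: k1; rewrite ler_pdivlMr // => k1.
    by rewrite ED lee_fin exprD invfM ler_pdivlMr // mulrC.
  exists V; split=> //; apply: le_trans PV _; rewrite -EFinM lee_fin /K -mulrA.
  rewrite ler_pM2l // -powRM //; last exact: ltW.
  apply: (@le_trans _ _ ((2 ^+ (N + k))^-1 `^ s)).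
    rewrite !powR_pow2 ler_expR lerN2 ler_pM2r //.
    by rewrite ler_wpM2l // ltW.
  apply: ge0_ler_powR; rewrite ?nnegrE ?invr_ge0 ?mulr_ge0 ?(ltW (p2 _)) ?(ltW D0) //.
  move: k2; rewrite ltr_pdivrMr // exprS => k2.
  by rewrite exprD invfM ler_pdivrMr //; lra.
have delta0 : 0 < (2 ^+ N)^-1 :> R by rewrite invr_gt0.
have pre : ((m / 2 / K)%:E <= hausdorff_premeasure s (2 ^+ N)^-1 E)%E.
  apply: le_ereal_inf_tmp => _ [U [EU dU] <-].
  have /choice[V HV] : forall i, exists V, [/\ measurable V, G `&` Y @^-1` U i `<=` V &
      (P V <= K%:E * hausdorff_gauge s (U i))%E].
    by move=> i; apply: mass.
  have mV : measurable (\bigcup_i V i).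
    by apply: bigcup_measurable => i _; have [] := HV i.
  rewrite mulrC EFinM lee_pdivrMl //.
  apply: le_trans PG _; rewrite -nneseriesZl; last by move=> i _; exact: hausdorff_gauge_ge0.
  apply: (@le_trans _ _ (\sum_(0 <= i <oo) P (V i))%E).
    apply: measure_sigma_subadditive => //; first by move=> i; have [] := HV i.
    move=> w Gw; have [[Ew _] _] := Gw; have [i _ Ui] := EU _ Ew.
    by exists i => //; have [_ + _] := HV i; apply.
  by apply: lee_nneseries => // i _; have [] := HV i.
have : (0 < hausdorff_measure s E)%E; last by move=> /gt_eqF ->.
apply: lt_le_trans (_ : (m / 2 / K)%:E <= _)%E.
  by rewrite lte_fin divr_gt0.
apply: le_trans pre _; apply: ereal_sup_ubound.
by exists (2 ^+ N)^-1.
Qed.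

Lemma hausdorff_dim_measureE : hausdorff_dim_measure mu = entropy%:E.
Proof.
apply/eqP; rewrite eq_le; apply/andP; split.
  apply/lee_addgt0Pr => e e0; rewrite -EFinD; apply: hausdorff_dim_measure_le.
  by rewrite ltrDl.
apply: le_ereal_inf_tmp => _ [E [mE E0] <-].
apply: le_ereal_inf_tmp => _ [s [s0 Hs] <-].
rewrite lee_fin leNgt; apply/negP => hs.
by have := hausdorff_measure_neq0 mE E0 s0 hs; rewrite Hs eqxx.
Qed.

End HausdorffDimension.

(** * Dimensions of the Bernoulli measure *)

Lemma powR_log2 (R : realType) (x : R) : 0 < x -> 2 `^ (log2 x) = x.
Proof.
move=> x0; have l2 : 0 < ln 2 :> R by rewrite ln_gt0 // ltr1n.
by rewrite /powR gt_eqF // /log2 divfK ?gt_eqF // lnK.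
Qed.

Lemma powR_normr_two_div (R : realType) (x theta : R) :
  `|x| `^ (2 / theta) = (x ^+ 2) `^ theta^-1.
Proof. by rewrite powRrM powR_mulrn // real_normK // num_real. Qed.

Lemma ln_lt_subr1 (R : realType) (x : R) : 0 < x -> x != 1 -> ln x < x - 1.
Proof.
move=> x0 x1; rewrite -ltr_expR lnK ?posrE //.
have : x - 1 != 0 by rewrite subr_eq0.
by move=> /expR_gt1Dx; rewrite addrC subrK.
Qed.

(** With [S = p^2 + (1 - p)^2] the left side is [- log2 S], the collision entropy, and the right
    side the Shannon entropy. Apply [ln x < x - 1] to [p / S] and [(1 - p) / S], neither of which is
    1; with weights [p] and [1 - p] the right sides cancel. *)
Lemma collision_entropy_lt (R : realType) (p : R) : 0 < p -> p < 1 -> p != 1 / 2 ->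
  1 - log2 (1 + (2 * p - 1) ^+ 2) < (p * ln p + (1 - p) * ln (1 - p)) / (- ln 2).
Proof.
move=> p0 p1 /eqP ph; have l2 : 0 < ln 2 :> R by rewrite ln_gt0 // ltr1n.
pose S := p ^+ 2 + (1 - p) ^+ 2.
have S0 : 0 < S by rewrite /S; nra.
have q0 : 0 < 1 - p by lra.
have -> : 1 + (2 * p - 1) ^+ 2 = 2 * S by rewrite /S; ring.
rewrite /log2 lnM ?posrE // mulrDl divff ?gt_eqF // opprD addrA subrr add0r.
rewrite invrN mulrN -!mulNr ltr_pM2r ?invr_gt0 // ltrN2.
have pS : p / S != 1.
  apply/eqP => H; have E : p = S by rewrite -[LHS](divfK (lt0r_neq0 S0)) H mul1r.
  have : (2 * p - 1) * (p - 1) = 0.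
    have : S - p = 0 by rewrite -E subrr.
    rewrite /S => <-; ring.
  move=> /eqP; rewrite mulf_eq0 => /orP[]/eqP H'; [apply: ph|]; lra.
have qS : (1 - p) / S != 1.
  apply/eqP => H; have E : 1 - p = S by rewrite -[LHS](divfK (lt0r_neq0 S0)) H mul1r.
  have : (2 * p - 1) * p = 0.
    have : S - (1 - p) = 0 by rewrite E subrr.
    rewrite /S => <-; ring.
  move=> /eqP; rewrite mulf_eq0 => /orP[]/eqP H'; [apply: ph|]; lra.
have L1 := ln_lt_subr1 (divr_gt0 p0 S0) pS.
have L2 := ln_lt_subr1 (divr_gt0 q0 S0) qS.
rewrite ln_div ?posrE // in L1; rewrite ln_div ?posrE // in L2.
have H1 : p * (ln p - ln S) < p * (p / S - 1) by rewrite ltr_pM2l.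
have H2 : (1 - p) * (ln (1 - p) - ln S) < (1 - p) * ((1 - p) / S - 1) by rewrite ltr_pM2l.
have H3 : p * (p / S - 1) + (1 - p) * ((1 - p) / S - 1) = 0.
  have -> : p * (p / S - 1) + (1 - p) * ((1 - p) / S - 1) = S / S - 1 by rewrite {3}/S; ring.
  by rewrite divff ?subrr // gt_eqF.
nra.
Qed.

Lemma powR_lt_self (R : realType) (b t : R) : 0 < b -> b < 1 -> 1 < t -> b `^ t < b.
Proof.
move=> b0 b1 t1; rewrite /powR gt_eqF // -[ltRHS]lnK ?posrE // ltr_expR.
have : ln b < 0 by rewrite ln_lt0 // b0.
nra.
Qed.

(** [ln (1 + x) <= x], and [expR y >= y] at [y = - ln b / theta]. This rate shows that the error
    term vanishes as [theta] tends to 0. *)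
Lemma log2_1D_powR_le (R : realType) (b theta : R) : 0 < b -> b < 1 -> 0 < theta ->
  log2 (1 + b `^ theta^-1) <= theta / (- ln b * ln 2).
Proof.
move=> b0 b1 th0; have l2 : 0 < ln 2 :> R by rewrite ln_gt0 // ltr1n.
have lb : 0 < - ln b by rewrite oppr_gt0 ln_lt0 // b0.
have bt0 : 0 < b `^ theta^-1 by rewrite powR_gt0.
rewrite /log2 invfM mulrA ler_pM2r ?invr_gt0 //.
apply: (@le_trans _ _ (b `^ theta^-1)).
  rewrite -ler_expR lnK ?posrE; [exact: expR_ge1Dx|lra].
have -> : b `^ theta^-1 = (expR (- ln b / theta))^-1.
  by rewrite /powR gt_eqF // -expRN; congr expR; rewrite mulNr opprK mulrC.
rewrite -[leRHS]invf_div lef_pV2 ?posrE ?expR_gt0 ?divr_gt0 //.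
by apply: le_trans (expR_ge1Dx _); rewrite lerDr.
Qed.

Section BernoulliConvolution.
Context (R : realType) (p : R) (d : measure_display) (T : measurableType d)
  (P : probability T R) (X : nat -> {RV P >-> R}) (Y : {RV P >-> R}).
Hypotheses (hp0 : 0 < p) (hp1 : p < 1) (hp : p != 1 / 2)
  (hX : mutually_independent X)
  (hX0 : forall n, P (X n @^-1` [set 0]) = p%:E)
  (hX1 : forall n, P (X n @^-1` [set 1]) = (1 - p)%:E)
  (hS : {ae P, forall w,
       series (fun n => X n w * (1 / 2) ^+ n.+1) @ \oo --> Y w}).

Local Notation mu := (distribution P Y).
Local Notation leb := (@lebesgue_measure R).
Local Notation b := ((2 * p - 1) ^+ 2).

Let mmu : measurable_fun setT (fourier_power mu) :=
  measurable_fourier_power hX hX0 hX1 hS.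
Let mu1 : forall z, fourier_power mu z <= 1 :=
  fourier_power_le1 hp0 hp1 hX hX0 hX1 hS.

(** The interval [[- 2 ^ k, 2 ^ k]] consists of two periods of the truncated product, whence the
    factor 2. *)
Lemma ball_energy_pow2_le t k : 1 <= t ->
  (ball_energy mu t (2 ^+ k) <= (2 * (1 + b `^ t) ^+ k)%:E)%E.
Proof.
move=> t1; have t0 : 0 <= t by lra.
have p2 : 0 < 2 ^+ k :> R by rewrite exprn_gt0.
rewrite /ball_energy sym_itvE.
have mr D : measurable D -> measurable_fun D (fun z => (riesz_product p k z `^ t)%:E).
  by move=> mD; exact: measurable_riesz_powR.
apply: (@le_trans _ _ (\int[leb]_(z in `[(- 2 ^+ k)%R, (2 ^+ k)%R]) (riesz_product p k z `^ t)%:E)%E).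
  apply: ge0_le_integral => //.
  - by move=> z _; rewrite lee_fin powR_ge0.
  - exact: measurable_fourier_powR.
  - exact: mr.
  - move=> z _; rewrite lee_fin; apply: ge0_ler_powR => //.
    + by rewrite nnegrE fourier_power_ge0.
    + by rewrite nnegrE riesz_product_ge0.
    + exact: (fourier_power_le_riesz hp0 hp1 hX hX0 hX1 hS).
have -> : `[- 2 ^+ k, 2 ^+ k]%classic = `[- 2 ^+ k, (- 2 ^+ k + 2 ^+ k + 2 ^+ k)]%classic :> set R.
  by rewrite addNr add0r.
rewrite integral_fold ?(ltW p2) //; last 2 first.
- exact: continuous_riesz_product_powR.
- by move=> z; exact: powR_ge0.
apply: (@le_trans _ _ (\int[leb]_(z in `[(- 2 ^+ k)%R, (- 2 ^+ k + 2 ^+ k)%R])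
    (2%:E * (riesz_product p k z `^ t)%:E))%E).
  rewrite le_eqVlt; apply/orP; left; apply/eqP; apply: eq_integral => z _.
  have -> : z + 2 ^+ k = z + (1 * 2 ^ k)%:R by rewrite mul1n natrX.
  by rewrite riesz_productDpow2 -EFinM; congr (_%:E); ring.
rewrite ge0_integralZl_EFin //; last 2 first.
- by move=> z _; rewrite lee_fin powR_ge0.
- exact: mr.
by rewrite EFinM lee_wpmul2l // ?lee_fin // integral_riesz_product_le.
Qed.

Lemma ball_energy_le t r : 1 <= t -> 1 < r ->
  (ball_energy mu t r <= (2 * (1 + b `^ t) * r `^ log2 (1 + b `^ t))%:E)%E.
Proof.
move=> t1 r1; have [k /andP[k1 k2]] := dyadic_scale (ltW r1).
set B := 1 + b `^ t.
have B1 : 1 <= B by rewrite lerDl powR_ge0.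
have B0 : 0 < B by lra.
have l2 : 0 < ln 2 :> R by rewrite ln_gt0 // ltr1n.
apply: le_trans (ball_energy_mono mmu t (ltW k2)) _.
apply: le_trans (ball_energy_pow2_le k.+1 t1) _.
rewrite lee_fin -/B exprS -!mulrA !ler_pM2l //.
rewrite -{1}(powR_log2 B0) -powR_exprn //.
apply: ge0_ler_powR; rewrite ?nnegrE ?exprn_ge0 //; last lra.
by rewrite divr_ge0 ?(ltW l2) // ln_ge0.
Qed.

Lemma fourier_lower_bound_gt0 : 0 < b ^+ 4 * cos (pi / 4) ^+ 2.
Proof.
have /andP[b0 _] := bernoulli_bias hp0 hp1 hp.
apply: mulr_gt0; apply: exprn_gt0 => //; apply: cos_gt0_pihalf.
by have := pi_gt0 R; move=> ?; apply/andP; split; lra.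
Qed.

Local Notation c := (b ^+ 4 * cos (pi / 4) ^+ 2).

(** On [[0, 2 ^ k]] the tail beyond the first [k] factors is [fourier_power] at a point of [[0, 1]],
    hence at least [c]; the integral of these [k] factors is known exactly. *)
Lemma ball_energy1_pow2_ge k :
  ((c * (1 + b) ^+ k)%:E <= ball_energy mu 1 (2 ^+ k))%E.
Proof.
have p2 : 0 < 2 ^+ k :> R by rewrite exprn_gt0.
have c0 := ltW fourier_lower_bound_gt0.
apply: (@le_trans _ _ (\int[leb]_(z in `[0%R, (0 + 2 ^+ k)%R])
    (c%:E * (riesz_product p k z)%:E))%E).
  rewrite ge0_integralZl_EFin //; last 2 first.
  - by move=> z _; rewrite lee_fin riesz_product_ge0.
  - apply/measurable_EFinP; apply: measurable_funTS; apply: continuous_measurable_fun.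
    exact: continuous_riesz_product.
  by rewrite EFinM lee_wpmul2l // ?lee_fin // integral_riesz_product.
apply: (@le_trans _ _ (\int[leb]_(z in `[0%R, (0 + 2 ^+ k)%R]) (fourier_power mu z `^ 1)%:E)%E).
  apply: ge0_le_integral => //.
  - by move=> z _; rewrite -EFinM lee_fin mulr_ge0 // riesz_product_ge0.
  - apply: emeasurable_funM => //.
    apply/measurable_EFinP; apply: measurable_funTS; apply: continuous_measurable_fun.
    exact: continuous_riesz_product.
  - exact: measurable_fourier_powR.
  - move=> z; rewrite /= in_itv /= add0r => /andP[z0 z1].
    rewrite -EFinM lee_fin powRr1 ?fourier_power_ge0 //.
    rewrite (fourier_power_riesz hX hX0 hX1 hS k) mulrC.
    rewrite ler_wpM2l ?riesz_product_ge0 //.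
    apply: (fourier_power_near_le2 hp0 hp1 hX hX0 hX1 hS).
    rewrite ger0_norm ?divr_ge0 ?(ltW p2) //.
    by rewrite ler_pdivrMr //; lra.
apply: ge0_subset_integral.
- exact: measurable_itv.
- exact: measurable_sym.
- by apply: measurable_fourier_powR => //; exact: measurable_sym.
- by move=> z _; rewrite lee_fin powR_ge0.
- by move=> z; rewrite /= in_itv /= add0r => /andP[z0 z1]; rewrite ger0_norm.
Qed.

Lemma ball_energy1_ge r : 1 < r ->
  ((c / (1 + b) * r `^ log2 (1 + b))%:E <= ball_energy mu 1 r)%E.
Proof.
move=> r1; have [k /andP[k1 k2]] := dyadic_scale (ltW r1).
have B0 : 0 < 1 + b by rewrite ltr_pwDl // sqr_ge0.
have l2 : 0 < ln 2 :> R by rewrite ln_gt0 // ltr1n.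
apply: le_trans (ball_energy_mono mmu 1 k1).
apply: le_trans (ball_energy1_pow2_ge k).
rewrite lee_fin -mulrA ler_pM2l ?fourier_lower_bound_gt0 // ler_pdivrMl // -exprS.
rewrite -[in leRHS](powR_log2 B0) -powR_exprn //.
apply: ge0_ler_powR; rewrite ?nnegrE ?exprn_ge0 ?(ltW k2) //; last lra.
by rewrite divr_ge0 ?(ltW l2) // ln_ge0 // lerDl sqr_ge0.
Qed.

(** Each doubling of the radius adds an interval of length 1/8 to the right of [2 ^ k]. There
    [fourier_power_shift] bounds the squared modulus below by a product of two factors, each at
    least [c]. *)
Lemma ball_energy_pow2_unbounded t k : 0 <= t ->
  ((k%:R * ((c ^+ 2) `^ t / 8))%:E <= ball_energy mu t (2 ^+ k))%E.
Proof.
move=> t0; elim: k => [|k IH]; first by rewrite mul0r ball_energy_ge0.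
have p1 : 1 <= 2 ^+ k :> R by rewrite exprn_ege1 // ler1n.
have p2 : 0 < 2 ^+ k :> R by lra.
have c0 := ltW fourier_lower_bound_gt0.
rewrite -natr1 mulrDl mul1r EFinD.
have mI : measurable (`](2 ^+ k)%R, (2 ^+ k + 1 / 8)%R] : set R) by exact: measurable_itv.
have mS := measurable_sym (2 ^+ k : R).
apply: (@le_trans _ _ (\int[leb]_(z in [set z : R | (`|z| <= 2 ^+ k)%R] `|`
    `](2 ^+ k)%R, (2 ^+ k + 1 / 8)%R]) (fourier_power mu z `^ t)%:E)%E); last first.
  apply: ge0_subset_integral.
  - exact: measurableU.
  - exact: measurable_sym.
  - by apply: measurable_fourier_powR => //; exact: measurable_sym.
  - by move=> z _; rewrite lee_fin powR_ge0.
  - move=> z /= []; first by move=> H; rewrite exprS; lra.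
    rewrite in_itv /= exprS => /andP[z1 z2]; rewrite ger0_norm; lra.
rewrite ge0_integral_setU //; last 3 first.
- by apply: measurable_fourier_powR => //; exact: measurableU.
- by move=> z _; rewrite lee_fin powR_ge0.
- rewrite disj_set2E; apply/eqP/seteqP; split=> z //= [H]; rewrite in_itv /= => /andP[z1 _].
  by have := ler_norm z; lra.
apply: leeD; first exact: IH.
apply: (@le_trans _ _ (\int[leb]_(z in `](2 ^+ k)%R, (2 ^+ k + 1 / 8)%R]) ((c ^+ 2) `^ t)%:E)%E).
  rewrite integral_cst //= lebesgue_measure_itv /= lte_fin ifT; last lra.
  by rewrite -EFinB -EFinM lee_fin ler_wpM2l ?powR_ge0 //; lra.
apply: ge0_le_integral => //.
- by move=> z _; rewrite lee_fin powR_ge0.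
- exact: measurable_fourier_powR.
- move=> z; rewrite /= in_itv /= => /andP[z1 z2]; rewrite lee_fin.
  apply: ge0_ler_powR => //; first by rewrite nnegrE exprn_ge0.
    by rewrite nnegrE fourier_power_ge0.
  have -> : z = 2 ^+ k + (z - 2 ^+ k) by ring.
  set y := z - 2 ^+ k.
  have y0 : 0 <= y by rewrite /y; lra.
  have y8 : y <= 1 / 8 by rewrite /y; lra.
  have yk0 : 0 <= y / 2 ^+ k by rewrite divr_ge0 // ltW.
  have yk : y / 2 ^+ k <= y by rewrite ler_pdivrMr // ler_peMr.
  apply: le_trans (fourier_power_shift hp0 hp1 hX hX0 hX1 hS k y).
  rewrite expr2; apply: ler_pM => //.
    by apply: (fourier_power_near_le2 hp0 hp1 hX hX0 hX1 hS); rewrite ger0_norm; lra.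
  by apply: (fourier_power_near_le2 hp0 hp1 hX hX0 hX1 hS); rewrite ger0_norm; lra.
Qed.

(** Finite energy at some [s > theta] would bound the ball integrals uniformly in the radius,
    against [ball_energy_pow2_unbounded]. *)
Lemma fourier_spectrum_le theta : 0 < theta -> (fourier_spectrum mu theta <= theta%:E)%E.
Proof.
move=> th0; rewrite /fourier_spectrum ge_max lee_fin (ltW th0) /=.
apply: ge_ereal_sup => _ [s [s0 sJ] <-]; rewrite lee_fin leNgt; apply/negP => ths.
have [K K0 HK] := ball_energy_of_fourier_energy th0 mmu mu1 sJ.
have m0 : Num.max 0 (1 - s / theta) = 0.
  by apply/max_idPl; rewrite subr_le0 ler_pdivlMr // mul1r ltW.
have ti0 : 0 <= theta^-1 by rewrite invr_ge0 ltW.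
set e := (c ^+ 2) `^ theta^-1 / 8.
have e0 : 0 < e by rewrite divr_gt0 // powR_gt0 // exprn_gt0 // fourier_lower_bound_gt0.
pose k := Num.bound (K / e).
have kK : K < k%:R * e.
  rewrite -ltr_pdivrMr //; apply: archi_boundP.
  by rewrite divr_ge0 // ltW.
have k1 : 1 <= 2 ^+ k :> R by rewrite exprn_ege1 // ler1n.
have := le_trans (ball_energy_pow2_unbounded k ti0) (HK _ k1).
by rewrite m0 powRr0 mulr1 lee_fin -/e leNgt kK.
Qed.

Lemma lower_fourier_decay_ge_log2 theta : 0 < theta -> theta <= 1 ->
  ((theta - theta * log2 (1 + b `^ theta^-1))%:E <= lower_fourier_decay mu theta)%E.
Proof.
move=> th0 th1.
have ti1 : 1 <= theta^-1 by rewrite invf_ge1.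
have -> : theta - theta * log2 (1 + b `^ theta^-1) =
  theta * (1 - log2 (1 + b `^ theta^-1)) by ring.
apply: (@lower_fourier_decay_ge _ _ _ th0 (2 * (1 + b `^ theta^-1))).
  by rewrite mulr_gt0 // ltr_pwDl // powR_ge0.
by move=> r r1; exact: ball_energy_le.
Qed.

Lemma lower_fourier_decay1 :
  lower_fourier_decay mu 1 = (1 - log2 (1 + b))%:E.
Proof.
apply/eqP; rewrite eq_le; apply/andP; split; last first.
  have := lower_fourier_decay_ge_log2 ltr01 (lexx 1).
  by rewrite invr1 powRr1 ?sqr_ge0 // mul1r.
rewrite -[X in (_ <= X%:E)%E]mul1r.
apply: (@lower_fourier_decay_le _ _ _ ltr01 (c / (1 + b))).
  by rewrite divr_gt0 ?fourier_lower_bound_gt0 // ltr_pwDl // sqr_ge0.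
by move=> r r1; rewrite invr1; exact: ball_energy1_ge.
Qed.

Lemma log2_1Db : 0 < log2 (1 + b) < 1.
Proof.
have /andP[b0 b1] := bernoulli_bias hp0 hp1 hp.
have l2 : 0 < ln 2 :> R by rewrite ln_gt0 // ltr1n.
rewrite /log2 divr_gt0 ?ln_gt0 ?ltrDl //= ltr_pdivrMr // mul1r.
by rewrite ltr_ln ?posrE //; lra.
Qed.

(** Finite energy at a larger [s] would force ball growth of exponent [m < log2 (1 + b)], against
    the lower bound on ball integrals. Positivity of [log2 (1 + b)] makes the maximum with 0
    harmless. *)
Lemma sobolev_dimE : sobolev_dim mu = (1 - log2 (1 + b))%:E.
Proof.
have /andP[lb0 lb1] := log2_1Db.
apply/eqP; rewrite eq_le; apply/andP; split; last first.
  by rewrite -lower_fourier_decay1; exact: lower_fourier_decay_le_spectrum.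
rewrite /sobolev_dim /fourier_spectrum ge_max lee_fin subr_ge0 (ltW lb1) /=.
apply: ge_ereal_sup => _ [s [s0 sJ] <-]; rewrite lee_fin leNgt; apply/negP => hs.
have [K K0 HK] := ball_energy_of_fourier_energy ltr01 mmu mu1 sJ.
set m := Num.max 0 (1 - s / 1) in HK.
have mb : m < log2 (1 + b) by rewrite /m gt_max lb0 divr1 /=; lra.
have B0 : 0 < 1 + b by rewrite ltr_pwDl // sqr_ge0.
(* [K + 1] instead of [K] makes the contradiction strict. *)
have C0 : 0 < (K + 1) / (c / (1 + b)).
  by rewrite !divr_gt0 ?fourier_lower_bound_gt0 //; lra.
have [M HM] := powR_dominates C0 mb.
pose r := Num.max M 1 + 1.
have Mr : M < r by rewrite /r ltr_pwDr // le_max lexx.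
have r1 : 1 < r by rewrite /r ltr_pwDr // le_max lexx orbT.
have := le_trans (ball_energy1_ge r1) _.
move=> /(_ (K * r `^ m)%:E); rewrite -[X in ball_energy mu X r]invr1 => /(_ (HK r (ltW r1))).
rewrite lee_fin leNgt => /negP; apply.
have H := HM r Mr r1.
have d0 : 0 < c / (1 + b) by rewrite divr_gt0 // fourier_lower_bound_gt0.
apply: lt_le_trans (_ : (K + 1) * r `^ m <= _).
  by rewrite ltr_pM2r ?powR_gt0 //; lra.
by move: H; rewrite [leLHS]mulrAC ler_pdivrMr // [X in _ <= X -> _]mulrC.
Qed.

Lemma cvg_fourier_spectrum_ratio :
  ((fourier_spectrum mu theta * (theta^-1)%:E)%E @[theta --> 0^'+]) --> 1%E.
Proof.
have /andP[b0 b1] := bernoulli_bias hp0 hp1 hp.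
have l2 : 0 < ln 2 :> R by rewrite ln_gt0 // ltr1n.
pose K : R := (- ln b * ln 2)^-1.
apply: (@squeeze_cvge _ _ _ _ (fun theta => (1 - theta * K)%:E) _ (fun=> 1%E)).
- near=> theta.
  have th0 : 0 < theta by near: theta; exact: nbhs_right_gt.
  have th1 : theta <= 1 by near: theta; exact: nbhs_right_le.
  apply/andP; split.
    apply: (@le_trans _ _ ((theta - theta * log2 (1 + b `^ theta^-1))%:E * (theta^-1)%:E)%E).
      rewrite -EFinM lee_fin mulrBl divff ?gt_eqF // mulrAC divff ?gt_eqF // mul1r.
      by rewrite lerB // log2_1D_powR_le.
    rewrite lee_wpmul2r ?lee_fin ?invr_ge0 ?(ltW th0) //.
    apply: le_trans (lower_fourier_decay_ge_log2 th0 th1) _.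
    exact: lower_fourier_decay_le_spectrum.
  apply: (@le_trans _ _ (theta%:E * (theta^-1)%:E)%E).
    by rewrite lee_wpmul2r ?lee_fin ?invr_ge0 ?(ltW th0) // fourier_spectrum_le.
  by rewrite -EFinM divff ?gt_eqF.
- apply: cvg_EFin; first by near=> theta.
  rewrite -[X in _ --> X]subr0 -[X in _ - X](mul0r K).
  apply: cvgB; first exact: cvg_cst.
  apply: cvgM; last exact: cvg_cst.
  by apply: cvg_at_right_filter; exact: cvg_id.
- exact: cvg_cst.
Unshelve. all: by end_near. Qed.

End BernoulliConvolution.

Unset Implicit Arguments.

(* [X] is indexed from 0: [X n] is the coefficient of (1/2)^(n+1), and [Y] is
   the almost sure sum of the series. *)
Theorem corollary4p3 (R : realType) (p : R) (d : measure_display)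
    (T : measurableType d) (P : probability T R)
    (X : nat -> {RV P >-> R}) (Y : {RV P >-> R})
    (hp0 : 0 < p) (hp1 : p < 1) (hp : p != 1 / 2)
    (hX : mutually_independent X)
    (hX0 : forall n, P (X n @^-1` [set 0]) = p%:E)
    (hX1 : forall n, P (X n @^-1` [set 1]) = (1 - p)%:E)
    (hS : {ae P, forall w,
       series (fun n => X n w * (1 / 2) ^+ n.+1) @ \oo --> Y w}) :
  let mu : probability R R := distribution P Y in
  (forall theta : R, 0 < theta -> theta < 1 ->
     (lower_fourier_decay mu theta <= fourier_spectrum mu theta)%E /\
     ((theta - theta * log2 (1 + `|2 * p - 1| `^ (2 / theta)))%:E
        <= lower_fourier_decay mu theta)%E) /\
  (sobolev_dim mu = lower_fourier_decay mu 1 /\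
   lower_fourier_decay mu 1 = (1 - log2 (1 + `|2 * p - 1| ^+ 2))%:E) /\
  (forall theta : R, 0 < theta -> theta < 1 ->
     (theta%:E * sobolev_dim mu < fourier_spectrum mu theta)%E) /\
  (cvg ((fourier_spectrum mu theta * (theta^-1)%:E)%E @[theta --> 0^'+]) /\
   (1 <= lim ((fourier_spectrum mu theta * (theta^-1)%:E)%E @[theta --> 0^'+]))%E) /\
  ((sobolev_dim mu < hausdorff_dim_measure mu)%E /\
   hausdorff_dim_measure mu =
     ((p * ln p + (1 - p) * ln (1 - p)) / (- ln 2))%:E).
Proof.
move=> mu.
have mmu : measurable_fun setT (fourier_power mu) :=
  measurable_fourier_power hX hX0 hX1 hS.
have mu1 := fourier_power_le1 hp0 hp1 hX hX0 hX1 hS.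
have ge theta (th0 : 0 < theta) (th1 : theta < 1) :=
  lower_fourier_decay_ge_log2 hp0 hp1 hp hX hX0 hX1 hS th0 (ltW th1).
have F1 := lower_fourier_decay1 hp0 hp1 hp hX hX0 hX1 hS.
have S1 := sobolev_dimE hp0 hp1 hp hX hX0 hX1 hS.
have H := hausdorff_dim_measureE hp0 hp1 hX hX0 hX1 hS.
have cv := cvg_fourier_spectrum_ratio hp0 hp1 hp hX hX0 hX1 hS.
have FS theta (th0 : 0 < theta) :
    (lower_fourier_decay mu theta <= fourier_spectrum mu theta)%E.
  exact: lower_fourier_decay_le_spectrum.
split.
  move=> theta th0 th1; split; first exact: FS.
  by rewrite powR_normr_two_div; exact: ge.
split.
  by rewrite [sobolev_dim mu]S1 [lower_fourier_decay mu 1]F1 real_normK // num_real.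
split.
  (* Strictness comes from [b^(1 / theta) < b], where [b = (2p - 1)^2] lies strictly between 0 and
     1. *)
  move=> theta th0 th1; apply: lt_le_trans (FS _ th0).
  apply: lt_le_trans (ge _ th0 th1).
  have /andP[b0 b1] := bernoulli_bias hp0 hp1 hp.
  have l2 : 0 < ln 2 :> R by rewrite ln_gt0 // ltr1n.
  rewrite [sobolev_dim mu]S1 -EFinM lte_fin mulrBr mulr1 ltrD2l ltrN2 ltr_pM2l //.
  have bt0 := powR_ge0 ((2 * p - 1) ^+ 2) theta^-1.
  rewrite /log2 ltr_pM2r ?invr_gt0 // ltr_ln ?posrE; [|lra..].
  by rewrite ltrD2l powR_lt_self // invf_gt1.
split.
  split; first exact: cvgP cv.
  by rewrite (cvg_lim _ cv).
split; last exact: H.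
rewrite [sobolev_dim mu]S1 [hausdorff_dim_measure mu]H lte_fin.
exact: collision_entropy_lt.
Qed.
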